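(* Let $(\alpha_{n,k})_{n\geq k\geq 0}$ be non-zero real numbers such that $(\alpha_{n,k})_n$ converges in $\mathbb{R}$ for every $k\geq 0$, and let $\mu\subset\mathbb{N}$ be an increasing sequence. There exists a $\mathcal{C}^{\infty}$ function $f:\mathbb{R}\to\mathbb{R}$ such that, for any continuous function $h:\mathbb{R}\to\mathbb{R}$ with $h(0)=0$ and any compact set $K\subset\mathbb{R}$, there exists an increasing sequence $(\lambda_n)_n\subset\mu$ such that $$\sup_{x\in K}\left|\sum_{k=0}^{\lambda_n}\frac{f^{(k)}(0)}{k!}\alpha_{\lambda_n,k}x^{k+1}-h(x)\right|\rightarrow 0\quad\text{as }n\rightarrow+\infty.$$ In addition, the set $\mathcal{U}^{\mu}(\alpha\mathcal{X})\cap\mathcal{C}^{\infty}$ of all such functions $f$ is a dense $G_\delta$ subset of $\mathcal{C}^{\infty}(\mathbb{R})$ and contains, apart from $0$, a dense subspace and an infinite-dimensional closed subspace of $\mathcal{C}^{\infty}(\mathbb{R})$.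
   Context: $\mathcal{C}^{\infty}(\mathbb{R})$ is the Fréchet space of real-valued $\mathcal{C}^\infty$ functions on $\mathbb{R}$ with the topology defined by the semi-norms $p_n(f)=\sum_{k=0}^n\sup_{[-n,n]}|f^{(k)}|$, $n\geq 0$. ''Increasing'' for index sequences means strictly increasing. A set contains a subspace apart from $0$ if it contains all its non-zero elements. *)

(* Defs.v *)
From HB Require Import structures.
From mathcomp Require Import all_boot all_order all_algebra.
From mathcomp Require Import all_classical all_reals all_analysis.
From mathcomp Require Import borel_hierarchy.

Set Implicit Arguments.
Unset Strict Implicit.
Unset Printing Implicit Defensive.
Import Order.TTheory GRing.Theory Num.Theory.
Import numFieldNormedType.Exports.
Local Open Scope classical_set_scope.
Local Open Scope ring_scope.

Local Notation "f ^` ( n )" := (derive1n n f) : ring_scope.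

Definition smooth (R : realType) (f : R -> R) : Prop :=
  forall (n : nat) (x : R), derivable (f^`(n)) x 1.

Definition smooth_pred (R : realType) : {pred R -> R} :=
  mem [set f : R -> R | smooth f].

Record smoothFun (R : realType) := SmoothFun {
  smooth_val :> R -> R;
  _ : smooth_val \in @smooth_pred R }.

HB.instance Definition _ (R : realType) :=
  [isSub of smoothFun R for @smooth_val R].
HB.instance Definition _ (R : realType) := [Choice of smoothFun R by <:].

Section smooth_lmodule.
Variable R : realType.
Implicit Types (f g : R -> R) (a : R).

Lemma smoothFunP (f : smoothFun R) : smooth f.
Proof. by case: f => f /= /set_mem. Qed.

Lemma derive1n_cst0 n : (0 : R -> R)^`(n) = 0.
Proof.
elim: n => // n IHn; rewrite derive1nS IHn; apply/funext => x.
exact: derive1_cst.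
Qed.

Lemma smooth0 : smooth (0 : R -> R).
Proof. by move=> n x; rewrite derive1n_cst0; exact: derivable_cst. Qed.

Lemma derive1n_linear a f g n : smooth f -> smooth g ->
  (a *: f + g)^`(n) = a *: f^`(n) + g^`(n).
Proof.
move=> sf sg; elim: n => // n IHn; rewrite !derive1nS IHn.
apply/funext => x.
have df := sf n x; have dg := sg n x.
rewrite [LHS]derive1E (deriveD (derivableZ df) dg) (deriveZ a df).
by rewrite -!derive1E.
Qed.

Lemma smooth_submod_closed : submod_closed (@smooth_pred R).
Proof.
split; first exact/mem_set/smooth0.
move=> a f g /set_mem sf /set_mem sg; apply/mem_set => n x.
rewrite (derive1n_linear a n sf sg); exact: (derivableD (derivableZ (sf n x)) (sg n x)).
Qed.

HB.instance Definition _ := GRing.isSubmodClosed.Build R (R -> R)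
  (@smooth_pred R) smooth_submod_closed.
HB.instance Definition _ := [SubChoice_isSubLmodule of smoothFun R by <:].

End smooth_lmodule.

Definition smooth_seminorm (R : realType) (n : nat)
    (f : smoothFun R) : R :=
  \sum_(k < n.+1) sup [set `|f^`(k) x| | x in `[- n%:R, n%:R]].

Section smooth_topology.
Variable R : realType.
Implicit Types (f g h : smoothFun R).
Local Notation p := (@smooth_seminorm R).

Let I n : set R := `[- n%:R, n%:R].

Let I_neq0 n : I n !=set0.
Proof. by exists 0; rewrite /I/= in_itv/= oppr_le0 ler0n. Qed.

Let has_sup_derive1n f n k : has_sup [set `|f^`(k) x| | x in I n].
Proof.
apply: compact_has_sup; first by have [x Ix] := I_neq0 n; exists `|f^`(k) x|, x.
apply: continuous_compact; last exact: segment_compact.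
apply: continuous_subspaceT => x; apply: cvg_norm.
exact/differentiable_continuous/derivable1_diffP/smoothFunP.
Qed.

Let ler_sup f n k x : I n x -> `|f^`(k) x| <= sup [set `|f^`(k) x| | x in I n].
Proof.
by move=> Ix; apply: ub_le_sup; [case: (has_sup_derive1n f n k)|exists x].
Qed.

Let sup_ge0 f n k : 0 <= sup [set `|f^`(k) x| | x in I n].
Proof. by have [x Ix] := I_neq0 n; exact: le_trans (normr_ge0 _) (ler_sup f k Ix). Qed.

Lemma smooth_seminorm0 n : p n 0 = 0.
Proof.
rewrite /p big1// => k _; rewrite (_ : [set _ | _ in _] = [set 0]) ?sup1//.
apply/seteqP; split => [_ [x _ <-]|_ ->] /=.
  by rewrite derive1n_cst0 normr0.
by have [x Ix] := I_neq0 n; exists x => //; rewrite derive1n_cst0 normr0.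
Qed.

Lemma smooth_seminormN n f : p n (- f) = p n f.
Proof.
apply: eq_bigr => k _; congr (sup _); apply: eq_imagel => x _.
rewrite -[X in X^`(k)]/(- (f : R -> R)) -scaleN1r -[_ *: _]addr0.
rewrite (derive1n_linear _ _ (@smoothFunP _ f) (@smooth0 R)).
by rewrite derive1n_cst0 addr0 scaleN1r/= normrN.
Qed.

Lemma ler_smooth_seminormD n f g : p n (f + g) <= p n f + p n g.
Proof.
rewrite -big_split; apply: ler_sum => k _; apply: ge_sup.
  by have [x Ix] := I_neq0 n; exists `|(f + g)^`(k) x|, x.
move=> _ [x Ix <-].
have -> : (f + g)^`(k) x = f^`(k) x + g^`(k) x.
  have := derive1n_linear 1 k (@smoothFunP _ f) (@smoothFunP _ g).
  by rewrite !scale1r => ->.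
apply: le_trans (ler_normD (f^`(k) x) (g^`(k) x)) _.
exact: lerD (ler_sup f k Ix) (ler_sup g k Ix).
Qed.

Lemma le_smooth_seminorm m n f : (m <= n)%N -> p m f <= p n f.
Proof.
move=> mn; rewrite /p (big_ord_widen n.+1
  (fun k => sup [set `|f^`(k) x| | x in I m])) ?ltnS// big_mkcond/=.
apply: ler_sum => k _; case: ifP => _; last exact: sup_ge0.
apply: ge_sup; first by have [x Ix] := I_neq0 m; exists `|f^`(k) x|, x.
move=> _ [x Ix <-]; apply: (ler_sup f k); move: Ix; rewrite /I/= !in_itv/=.
move=> /andP[mx xm]; rewrite (le_trans _ mx) ?lerN2 ?ler_nat//=.
by rewrite (le_trans xm)// ler_nat.
Qed.

(* The seminorms increase with [n] (le_smooth_seminorm), so the sets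
   [{(f, g) | p n (f - g) < e}] form a filter basis, and the induced topology
   is the locally convex one defined by the whole family; nbhs_smoothP spells
   it out. *)
Definition smooth_entourage : set_system (smoothFun R * smoothFun R) :=
  filter_from [set ne : nat * R | 0 < ne.2]
    (fun ne => [set fg : smoothFun R * smoothFun R |
       p ne.1 (fg.1 - fg.2) < ne.2]).

Let entourage_filter : Filter smooth_entourage.
Proof.
apply: filter_from_filter; first by exists (0%N, 1) => /=.
move=> [m d] [n e] /= d0 e0; exists (maxn m n, Num.min d e) => /=.
  by rewrite lt_min d0.
move=> [f g] /=; rewrite lt_min => /andP[fd fe]; split => /=.
  by apply: le_lt_trans fd; exact/le_smooth_seminorm/leq_maxl.
by apply: le_lt_trans fe; exact/le_smooth_seminorm/leq_maxr.
Qed.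

Let entourage_diagonal A : smooth_entourage A -> diagonal `<=` A.
Proof.
move=> [[n e] /= e0 eA] [f g] fg; apply: eA => /=.
have -> : f = g by exact: fg.
by rewrite subrr smooth_seminorm0.
Qed.

Let entourage_inv A : smooth_entourage A -> smooth_entourage A^-1%relation.
Proof.
move=> [[n e] /= e0 eA]; exists (n, e) => // -[f g] /= fg; apply: eA => /=.
by rewrite -smooth_seminormN opprB.
Qed.

Let entourage_split A : smooth_entourage A ->
  exists2 B, smooth_entourage B & (B \; B `<=` A)%relation.
Proof.
move=> [[n e] /= e0 eA].
exists [set fg : smoothFun R * smoothFun R | p n (fg.1 - fg.2) < e / 2].
  by exists (n, e / 2) => //=; rewrite divr_gt0.
move=> [f g] /= [h /= fh hg]; apply: eA => /=.
rewrite -(subrK h f) -addrA [ltRHS]splitr.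
by rewrite (le_lt_trans (ler_smooth_seminormD _ _ _))// ltrD.
Qed.

HB.instance Definition _ := isUniform.Build (smoothFun R)
  entourage_filter entourage_diagonal entourage_inv entourage_split.

Lemma nbhs_smoothP f (A : set (smoothFun R)) :
  nbhs f A <-> exists n e, 0 < e /\ [set g : smoothFun R | p n (f - g) < e] `<=` A.
Proof.
split=> [/nbhsP[B [[n e] /= e0 eB] BA]|[n [e [e0 eA]]]].
  by exists n, e; split=> // g fg; apply: BA; exact/mem_set/eB.
apply/nbhsP; exists [set fg : smoothFun R * smoothFun R | p n (fg.1 - fg.2) < e]; first by exists (n, e).
by move=> g /set_mem; exact: eA.
Qed.

End smooth_topology.

Section subspaces.
Variables (R : realType) (E : lmodType R).

Definition linear_subspace (V : set E) : Prop := submod_closed (mem V).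

Definition finite_dimensional (V : set E) : Prop :=
  exists n (v : 'I_n -> E), (forall i, V (v i)) /\
    forall w, V w -> exists c : 'I_n -> R, w = \sum_(i < n) c i *: v i.

Definition contains_apart0 (U V : set E) : Prop := V `\ 0 `<=` U.

End subspaces.

(* Only the entries [alpha n k] with [k <= n] are used. *)
Definition weighted_taylor (R : realType) (alpha : nat -> nat -> R) (n : nat)
    (f : R -> R) (x : R) : R :=
  \sum_(k < n.+1) f^`(k) 0 / k`!%:R * alpha n k * x ^+ k.+1.

(* The supremum is a real [sup]: the set is bounded because [K] is compact and
   the summands and [h] are continuous, and [sup set0 = 0] when [K] is empty. *)
Definition universal_series (R : realType) (alpha : nat -> nat -> R)
    (mu : nat -> nat) (f : R -> R) : Prop :=
  forall h : R -> R, continuous h -> h 0 = 0 ->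
  forall K : set R, compact K ->
  exists lambda : nat -> nat,
    [/\ increasing_seq lambda, range lambda `<=` range mu &
      sup [set `|weighted_taylor alpha (lambda n) f x - h x| | x in K]
        @[n --> \oo] --> 0].

Definition universal_smooth (R : realType) (alpha : nat -> nat -> R)
    (mu : nat -> nat) : set (smoothFun R) :=
  [set f : smoothFun R | universal_series alpha mu f].

(* Main.v *)
(** The set of universal functions depends on [f] only through its derivatives
    at 0. Given the derivatives up to order [N], the next ones can be chosen so
    that a partial sum of large index is close to any target: flat functions
    [x^(N+2) q(x)] are dense among the continuous functions vanishing at 0, the
    contribution of the orders [<= N] converges, and dividing by the non-zero
    [alpha n k] gives the wanted derivatives. Derivatives of order [> N] cost
    nothing in the [N]-th seminorm, thanks to [t^(-k) (sin tx + cos tx)] with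
    [t] large.

    Doing this in turn for a sequence of functions [f_l] and all rational
    targets, one makes at each stage the partial sum of one [f_l] close to the
    target and those of the other ones already introduced close to 0. A
    combination of the [f_l], possibly infinite, with bounded coefficients is
    then universal as soon as it has a non-zero coefficient. Moreover
    [f_l = x^(K_l) + g_l] with [K_l] lacunary and [g_l] small. Lacunary powers
    behave like a basis whose coefficients are controlled by the seminorms, so
    each element of the closed span of the [f_l] has such coefficients, and it
    is 0 if they all vanish: this is the closed subspace. Adding small multiples
    of the [f_l] to a dense sequence of polynomials, which only translate the
    targets, gives the dense subspace. *)
Require Import Defs.
From HB Require Import structures.
From mathcomp Require Import all_boot all_order all_algebra.
From mathcomp Require Import all_classical all_reals all_analysis.
From mathcomp Require Import borel_hierarchy ring lra zify.
Import Order.TTheory GRing.Theory Num.Theory.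
Import numFieldNormedType.Exports.
Local Open Scope classical_set_scope.
Local Open Scope ring_scope.
Set Implicit Arguments.
Unset Strict Implicit.
Unset Printing Implicit Defensive.
Local Notation "f ^` ( n )" := (derive1n n f) : ring_scope.

(** * Polynomial approximation *)

Section weierstrass.
Variable R : realType.
Implicit Types (h : R -> R) (g : nat -> R) (p : {poly R}).

Lemma invSn_lt (e : R) : 0 < e ->
  exists N, forall n, (N <= n)%N -> n.+1%:R^-1 < e.
Proof.
by move=> e0; have [N _ NP] := near_infty_natSinv_lt (PosNum e0); exists N.
Qed.

(** Compactness of [[- a, a]] in its near-covering form gives the uniform [d]. Only [x] is confined
    to the interval, so [a = 0] yields plain continuity at 0. *)
Lemma heine h (a : R) e : continuous h -> 0 < e ->
  exists2 d, 0 < d &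
    forall x y, `|x| <= a -> `|y - x| < d -> `|h y - h x| < e.
Proof.
move=> ch e0.
have cK : compact `[- a, a] by exact: segment_compact.
have /compact_near_coveringP := cK.
move=> /(_ nat \oo (fun n x => forall y, `|y - x| < n.+1%:R^-1 ->
  `|h y - h x| < e) _).
case=> [x _|N _ NP].
  have /cvgrPdist_lt/(_ (e / 2)) := ch x.
  rewrite divr_gt0// => /(_ isT)[d /= d0 dP].
  have d20 : 0 < d / 2 by rewrite divr_gt0.
  have [N NP] := invSn_lt d20.
  exists (ball x (d / 2), [set n | (N <= n)%N]) => /=.
    by split; [exact: nbhsx_ballx|exists N].
  move=> [z n] /= [xz /NP nd] y yz.
  have hz : `|h x - h z| < e / 2.
    by apply: dP => /=; rewrite (lt_trans xz)// ltr_pdivrMr// ltr_pMr// ltr1n.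
  have hy : `|h x - h y| < e / 2.
    apply: dP => /=; rewrite -(subrK z x) -addrA (le_lt_trans (ler_normD _
      _))//.
    by rewrite [ltRHS]splitr ltrD// distrC (lt_trans yz).
  rewrite -(subrK (h x) (h y)) -addrA (le_lt_trans (ler_normD _ _))//.
  by rewrite [ltRHS]splitr ltrD// distrC.
exists N.+1%:R^-1; first by rewrite invr_gt0.
move=> x y xa yx; apply: (NP N) => //=; last by rewrite in_itv/= -ler_norml.
Qed.

Lemma continuous_bounded h (a : R) : continuous h ->
  exists2 M, 0 < M & forall x, `|x| <= a -> `|h x| <= M.
Proof.
move=> ch.
have [||c _ cP] := @EVT_max R (fun x => `|h x|) (- `|a|) `|a|.
- by rewrite (le_trans _ (normr_ge0 a))// oppr_le0.
- by apply: continuous_subspaceT => x; apply: cvg_norm; exact: ch.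
exists (`|h c| + 1) => [|x xa]; first by rewrite ltr_wpDl.
rewrite (le_trans (cP x _)) ?lerDl//.
by rewrite in_itv/= -ler_norml (le_trans xa)// ler_norm.
Qed.

(* [bernstein n g] evaluated at [x] is the expectation of [g] under the binomial
   law with parameters [n] and [x]: condition on the first trial. *)
Fixpoint bernstein n g : {poly R} :=
  if n is n'.+1 then
    (1 - 'X) * bernstein n' g + 'X * bernstein n' (g \o S)
  else (g 0%N)%:P.

Lemma hornerbernsteinS n g x : (bernstein n.+1 g).[x] =
  (1 - x) * (bernstein n g).[x] + x * (bernstein n (g \o S)).[x].
Proof. by rewrite /= !hornerE. Qed.

Lemma bernstein_linear n a b g1 g2 x :
  (bernstein n (fun k => a * g1 k + b * g2 k)).[x] =
  a * (bernstein n g1).[x] + b * (bernstein n g2).[x].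
Proof.
elim: n g1 g2 => [|n IHn] g1 g2; first by rewrite /= !hornerE.
rewrite !hornerbernsteinS IHn.
have := IHn (g1 \o S) (g2 \o S).
by rewrite [X in bernstein _ X](_ : _ = (fun k => a * g1 k + b * g2 k) \o S)//
  => ->; ring.
Qed.

Lemma ler_bernstein n g1 g2 x : 0 <= x <= 1 ->
  (forall k, (k <= n)%N -> g1 k <= g2 k) ->
  (bernstein n g1).[x] <= (bernstein n g2).[x].
Proof.
move=> /andP[x0 x1]; elim: n g1 g2 => [|n IHn] g1 g2 g12.
  by rewrite /= !hornerC g12.
rewrite !hornerbernsteinS lerD ?ler_wpM2l ?subr_ge0//; apply: IHn => k kn.
  by apply: g12; rewrite leqW.
by apply: g12.
Qed.

Lemma bernstein_cst n c x : (bernstein n (fun=> c)).[x] = c.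
Proof.
elim: n => [|n IHn]; first by rewrite /= hornerC.
by rewrite hornerbernsteinS [X in x * X]IHn IHn; ring.
Qed.

(** Variance plus squared bias of a binomial variable. The centre [c] stays arbitrary because
    conditioning on a successful first trial replaces it by [c - 1]. *)
Lemma bernstein_variance n (c x : R) :
  (bernstein n (fun k => (k%:R - c) ^+ 2)).[x] =
  n%:R * x * (1 - x) + (n%:R * x - c) ^+ 2.
Proof.
elim: n c => [|n IHn] c; first by rewrite /= hornerC; ring.
rewrite hornerbernsteinS IHn.
rewrite (_ : _ \o S = fun k => (k%:R - (c - 1)) ^+ 2); last first.
  apply/funext => k /=; have -> : k.+1%:R = k%:R + 1 :> R by rewrite natr1.
  by ring.
have -> : n.+1%:R = n%:R + 1 :> R by rewrite natr1.
by rewrite IHn; ring.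
Qed.

(** Chebyshev's argument: if [k / n] is within [d] of [x], uniform continuity applies; otherwise
    [(k / n - x)^2 / d^2 >= 1] absorbs the crude bound [2 * M]. The expectation of that quadratic
    term is a multiple of [x (1 - x) / n]. *)
Lemma weierstrass01 h e : continuous h -> 0 < e ->
  exists p, forall x, 0 <= x <= 1 -> `|h x - p.[x]| <= e.
Proof.
move=> ch e0; have e20 : 0 < e / 2 by rewrite divr_gt0.
have [d d0 hd] := heine 1 ch e20.
have [M M0 hM'] := continuous_bounded 1 ch.
have hM x : 0 <= x <= 1 -> `|h x| <= M.
  by case/andP=> x0 x1; apply: hM'; rewrite ger0_norm.
set C := 2 * M / d ^+ 2.
have C0 : 0 < C by rewrite divr_gt0 ?mulr_gt0// exprn_gt0.
have [N NP] : exists N : nat, forall x, 0 <= x <= 1 ->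
   C * (x * (1 - x) / N.+1%:R) <= e / 2.
  have [|N /(_ _ (leqnn _)) NP] := @invSn_lt (e / 2 / C); first by rewrite
    divr_gt0.
  exists N => x /andP[x0 x1]; rewrite -ler_pdivlMl// [leRHS]mulrC (le_trans _
    (ltW NP))//.
  by rewrite ler_piMl ?invr_ge0//; nra.
exists (bernstein N.+1 (fun k => h (k%:R / N.+1%:R))) => x x01.
have x1 : `|x| <= 1 by case/andP: x01 => x0 x1; rewrite ger0_norm.
have n0 : N.+1%:R != 0 :> R by [].
have bnd k : (k <= N.+1)%N ->
    `|h x - h (k%:R / N.+1%:R)| <=
      e / 2 + C / N.+1%:R ^+ 2 * (k%:R - N.+1%:R * x) ^+ 2.
  move=> kN.
  have [lt|ge] := ltP `|k%:R / N.+1%:R - x| d.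
    rewrite distrC (le_trans (ltW (hd _ _ x1 lt)))// lerDl mulr_ge0 ?sqr_ge0//.
    by rewrite divr_ge0 ?exprn_ge0// ltW.
  rewrite (le_trans (ler_normB _ _))//.
  have -> : C / N.+1%:R ^+ 2 * (k%:R - N.+1%:R * x) ^+ 2 =
            2 * M * ((k%:R / N.+1%:R - x) ^+ 2 / d ^+ 2).
    rewrite /C; move: (N.+1%:R) n0 => n' n0.
    by field; rewrite n0/= gt_eqF.
  have : 1 <= (k%:R / N.+1%:R - x) ^+ 2 / d ^+ 2.
    by rewrite ler_pdivlMr ?exprn_gt0// mul1r -[leRHS]real_normK ?num_real//
      ler_sqr// nnegrE ?ltW.
  have : `|h x| <= M by exact: hM.
  have : `|h (k%:R / N.+1%:R)| <= M.
    by apply: hM; rewrite divr_ge0//= ler_pdivrMr// mul1r ler_nat.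
  move: (_ / _) => t; nra.
have Ex : (bernstein N.+1 (fun k => e / 2 * 1 + C / N.+1%:R ^+ 2 * (k%:R -
  N.+1%:R * x) ^+ 2)).[x]
    <= e.
  rewrite bernstein_linear bernstein_cst bernstein_variance.
  have := NP _ x01; set t := C * _.
  have -> : C / N.+1%:R ^+ 2 * (N.+1%:R * x * (1 - x) + (N.+1%:R * x - N.+1%:R
    * x) ^+ 2) = t.
    by rewrite /t; field.
  lra.
have E2 : h x - (bernstein N.+1 (fun k => h (k%:R / N.+1%:R))).[x] =
    (bernstein N.+1 (fun k => 1 * h x + (-1) * h (k%:R / N.+1%:R))).[x].
  by rewrite bernstein_linear bernstein_cst; ring.
rewrite ler_norml E2; apply/andP; split; rewrite ?(le_trans _ Ex)//.
  rewrite lerNl.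
  rewrite (_ : - _ = (bernstein N.+1 (fun k =>
    -1 * (1 * h x + (-1) * h (k%:R / N.+1%:R)) + 0 * 0)).[x]); last first.
    by rewrite [RHS]bernstein_linear; ring.
  apply: le_trans Ex; apply: ler_bernstein => // k /bnd /=.
  by rewrite ler_norml; move: (C / _ * _) (h (_ / _)) => u v; lra.
by apply: ler_bernstein => // k /bnd /=; rewrite ler_norml;
  move: (C / _ * _) (h (_ / _)) => u v; lra.
Qed.

Lemma weierstrass h (M e : R) : continuous h -> 0 < e ->
  exists p, forall x, `|x| <= M -> `|h x - p.[x]| <= e.
Proof.
move=> ch e0.
wlog M0 : M / 0 < M.
  move=> /(_ (Num.max M 1)); rewrite lt_max ltr01 orbT => /(_ isT)[p pP].
  by exists p => x xM; apply: pP; rewrite le_max xM.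
pose k x := M * (2 * x - 1).
have ck : continuous (h \o k).
  move=> x; apply: continuous_comp; last exact: ch.
  have -> : k = horner (M *: (2 *: 'X - 1)).
    by apply/funext => y; rewrite !hornerE.
  exact: continuous_horner.
have [p pP] := weierstrass01 ck e0.
exists (p \Po (2^-1 *: (M^-1 *: 'X + 1))) => x.
rewrite ler_norml => /andP[x1 x2].
rewrite horner_comp !hornerE.
have M1 : M != 0 by rewrite gt_eqF.
have {1}-> : x = k (2^-1 * (M^-1 * x + 1)) by rewrite /k; field.
apply: pP.
have -> : 2^-1 * (M^-1 * x + 1) = (x + M) / (2 * M) by field.
rewrite divr_ge0 ?ler_pdivrMr ?mulr_gt0//=; lra.
Qed.

End weierstrass.

(** * Approximation by polynomials flat at 0 and by rational polynomials *)

Section flat_weierstrass.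
Variable R : realType.
Implicit Types (h : R -> R) (p : {poly R}).

Lemma mulr_div1p_le (u w e : R) : 0 <= e -> 0 <= w -> u <= w ->
  u * (e / (w + 1)) <= e.
Proof.
move=> e0 w0 uw; rewrite mulrCA ler_piMr// ler_pdivrMr ?ltr_wpDl// mul1r.
by rewrite (le_trans uw)// lerDl.
Qed.

Lemma onem_expr_le (r : R) n : 0 <= r <= 1 -> 1 - r ^+ n <= n%:R * (1 - r).
Proof.
move=> /andP[r0 r1]; elim: n => [|n IHn]; first by rewrite expr0 subrr mul0r.
have : 0 <= r ^+ n <= 1 by rewrite exprn_ge0// exprn_ile1.
have -> : n.+1%:R = n%:R + 1 :> R by rewrite natr1.
by rewrite exprS; move: (r ^+ n) IHn => u; nra.
Qed.

(* [h] is multiplied by [(x^2 / (x^2 + d))^N], which is close to 1 away from 0,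
   while [h] itself is small near 0. *)
Lemma flat_weierstrass h N (M e : R) : continuous h -> h 0 = 0 -> 0 < e ->
  exists p, forall x, `|x| <= M -> `|h x - ('X^N * p).[x]| <= e.
Proof.
move=> ch h0 e0.
have [|a a0 ha] := @heine R h 0 (e / 2) ch; first by rewrite divr_gt0.
have [B B0 hB] := continuous_bounded M ch.
(* For [|x| >= a] the damping factor [r] below satisfies [1 - r <= d / a^2], so [N * (1 - r)] is at
   most [e / 2 / B], which compensates the bound [B] on [h]. *)
pose d := a ^+ 2 * (e / 2 / B / N.+1%:R).
have d0 : 0 < d by rewrite mulr_gt0 ?exprn_gt0// !divr_gt0.
have xd x : 0 < x ^+ 2 + d by rewrite ltr_wpDl// sqr_ge0.
(* Here [x^N * k x] is the damped function [h x * r^N], so a polynomial close to the continuous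
   function [k] becomes, once multiplied by ['X^N], flat and close to it. *)
pose k x := h x * (x / (x ^+ 2 + d)) ^+ N.
have ck : continuous k.
  move=> x; apply: cvgM; first exact: ch.
  apply: (@continuous_comp R R R (fun y => y / (y ^+ 2 + d)) (fun y => y ^+ N)).
    apply: cvgM; first exact: cvg_id.
    apply: cvgV; first by rewrite gt_eqF.
    by apply: cvgD; [exact: exprn_continuous|exact: cvg_cst].
  exact: exprn_continuous.
have M0 : 0 < `|M| ^+ N + 1 by rewrite ltr_wpDl// exprn_ge0.
have [|p pP] := @weierstrass R k M (e / 2 / (`|M| ^+ N + 1)) ck.
  by rewrite !divr_gt0.
exists p => x xM; rewrite hornerM hornerXn.
pose r := x ^+ 2 / (x ^+ 2 + d).
have r01 : 0 <= r <= 1.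
  by rewrite divr_ge0 ?sqr_ge0 ?(ltW (xd x))//= ler_pdivrMr// mul1r lerDl ltW.
have kr : x ^+ N * k x = h x * r ^+ N.
  by rewrite /k mulrCA -exprMn /r mulrA expr2.
rewrite -(subrK (x ^+ N * k x) (h x)) -addrA -mulrBr (le_trans (ler_normD _
  _))//.
rewrite [leRHS]splitr lerD//; last first.
  rewrite normrM normrX (le_trans (ler_wpM2l _ (pP _ xM))) ?exprn_ge0//.
  apply: mulr_div1p_le; rewrite ?exprn_ge0 ?divr_ge0 ?(ltW e0)//.
  by rewrite lerXn2r ?nnegrE// (le_trans xM)// ler_norm.
rewrite kr -[X in X - _]mulr1 -mulrBr normrM.
have rN : 0 <= 1 - r ^+ N <= 1.
  by case/andP: r01 => r0 r1; rewrite subr_ge0 exprn_ile1//= gerBl exprn_ge0.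
rewrite (ger0_norm (x := 1 - _)); last by case/andP: rN.
have [xa|ax] := ltP `|x| a.
  have := ha 0 x; rewrite normr0 lexx h0 !subr0 => /(_ isT xa) /ltW hx.
  rewrite -[leRHS]mulr1 ler_pM//; by case/andP: rN.
have : 1 - r ^+ N <= e / 2 / B.
  rewrite (le_trans (onem_expr_le _ r01))//.
  have -> : 1 - r = d / (x ^+ 2 + d) by rewrite /r; field; rewrite gt_eqF.
  have xa2 : a ^+ 2 <= x ^+ 2 by rewrite -[leRHS]real_normK ?num_real//
    ler_sqr// nnegrE ltW.
  rewrite mulrA ler_pdivrMr//.
  have -> : N%:R * d = N%:R / N.+1%:R * (a ^+ 2 * (e / 2 / B)).
    have : N.+1%:R != 0 :> R by [].
    by rewrite /d; move: (N.+1%:R) => n n0; field; rewrite n0 gt_eqF.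
  rewrite (@le_trans _ _ (a ^+ 2 * (e / 2 / B)))//.
    rewrite ler_piMl ?ler_pdivrMr ?mul1r ?ler_nat//.
    by rewrite mulr_ge0 ?sqr_ge0// !divr_ge0// ltW.
  rewrite mulrC ler_wpM2l//; first by rewrite !divr_ge0// ltW.
  by rewrite (le_trans xa2)// lerDl ltW.
move=> rB; rewrite (le_trans (ler_pM _ _ (hB _ xM) rB))//; first by case/andP:
  rN.
by rewrite mulrC divfK// gt_eqF.
Qed.

Lemma rat_poly_approx p (M e : R) : 0 < e ->
  exists q : {poly rat}, forall x, `|x| <= M ->
    `|p.[x] - (map_poly ratr q).[x]| <= e.
Proof.
elim/poly_ind: p e => [|p c IHp] e e0.
  by exists 0 => x _; rewrite rmorph0 !horner0 subrr normr0 ltW.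
have M0 : 0 < `|M| + 1 by rewrite ltr_wpDl.
have [|q qP] := IHp (e / 2 / (`|M| + 1)); first by rewrite !divr_gt0.
have [c' c'P] : exists c' : rat, `|c - ratr c'| <= e / 2.
  have [|c'] := @rat_in_itvoo R (c - e / 2) (c + e / 2).
    by rewrite ltrD2l gtrN// divr_gt0.
  rewrite in_itv/= => /andP[c1 c2]; exists c'; rewrite ler_norml; lra.
exists (q * 'X + c'%:P) => x xM.
rewrite rmorphD rmorphM/= map_polyX map_polyC/= !hornerE.
have -> (a b u v : R) : a * x + u - (b * x + v) = (a - b) * x + (u - v) by ring.
rewrite (le_trans (ler_normD _ _))// [leRHS]splitr lerD// normrM.
rewrite (le_trans (ler_wpM2r _ (qP _ xM)))// mulrC.
by apply: mulr_div1p_le; rewrite ?(le_trans xM) ?ler_norm// divr_ge0// ltW.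
Qed.

End flat_weierstrass.

(** * Smooth functions and their seminorms *)

Section smooth_functions.
Variable R : realType.
Implicit Types (f g : smoothFun R) (a x : R).
Local Notation p := (@smooth_seminorm R).

Definition mkSmooth (f : R -> R) (sf : smooth f) : smoothFun R :=
  SmoothFun (mem_set sf).

Lemma derivable_derive1n f k x : derivable (f^`(k)) x 1.
Proof. exact: smoothFunP. Qed.

Lemma is_derive_derive1n f k x : is_derive x 1 (f^`(k)) (f^`(k.+1) x).
Proof.
by apply: DeriveDef; [exact: derivable_derive1n|rewrite derive1nS derive1E].
Qed.

Lemma continuous_derive1n f k : continuous (f^`(k)).
Proof.
move=> x; apply/differentiable_continuous/derivable1_diffP.
exact: derivable_derive1n.
Qed.

Lemma derive1n_smoothZD k a f g x :
  (a *: f + g)^`(k) x = a * f^`(k) x + g^`(k) x.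
Proof.
have := derive1n_linear a k (@smoothFunP _ f) (@smoothFunP _ g).
by move/(congr1 (fun u => u x)).
Qed.

Lemma derive1n_smooth0 k x : (0 : smoothFun R)^`(k) x = 0.
Proof. by have /(congr1 (fun u => u x)) := derive1n_cst0 R k. Qed.

Lemma derive1n_smoothZ k a f x : (a *: f)^`(k) x = a * f^`(k) x.
Proof. by rewrite -[a *: f]addr0 derive1n_smoothZD derive1n_smooth0 addr0. Qed.

Lemma derive1n_smoothD k f g x : (f + g)^`(k) x = f^`(k) x + g^`(k) x.
Proof. by rewrite -[in LHS](scale1r f) derive1n_smoothZD mul1r. Qed.

Lemma derive1n_smoothB k f g x : (f - g)^`(k) x = f^`(k) x - g^`(k) x.
Proof.
by rewrite addrC -scaleN1r derive1n_smoothZD mulN1r addrC.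
Qed.

Lemma derive1n_smooth_sum k (I : Type) (r : seq I) (P : pred I)
    (F : I -> smoothFun R) x :
  (\sum_(i <- r | P i) F i)^`(k) x = \sum_(i <- r | P i) (F i)^`(k) x.
Proof.
elim/big_rec2 : _ => [|i u v _ <-]; first exact: derive1n_smooth0.
exact: derive1n_smoothD.
Qed.

Lemma smooth_ext f g : (forall x, f x = g x) -> f = g.
Proof. by move=> fg; apply/val_inj/funext. Qed.

Lemma has_sup_derive1n f n k :
  has_sup [set `|f^`(k) x| | x in `[- n%:R, n%:R]].
Proof.
apply: compact_has_sup.
  by exists `|f^`(k) 0|, 0; rewrite //= in_itv/= oppr_le0 ler0n.
apply: continuous_compact; last exact: segment_compact.
apply: continuous_subspaceT => x; apply: cvg_norm; exact: continuous_derive1n.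
Qed.

Lemma ler_smooth_seminorm n f k x : (k <= n)%N -> `|x| <= n%:R ->
  `|f^`(k) x| <= p n f.
Proof.
move=> kn xn.
have sup_ge j : `|f^`(j) x| <= sup [set `|f^`(j) x| | x in `[- n%:R, n%:R]].
  apply: ub_le_sup; first by case: (has_sup_derive1n f n j).
  by exists x => //=; rewrite in_itv/= -ler_norml.
rewrite (le_trans (sup_ge k))// /smooth_seminorm.
have kn1 : (k < n.+1)%N by [].
rewrite (bigD1 (Ordinal kn1))//= lerDl sumr_ge0// => i _.
by rewrite (le_trans _ (sup_ge i)).
Qed.

Lemma smooth_seminorm_le n f e :
  (forall k x, (k <= n)%N -> `|x| <= n%:R -> `|f^`(k) x| <= e) ->
  p n f <= n.+1%:R * e.
Proof.
move=> fe; rewrite mulr_natl -[X in _ *+ X]card_ord -sumr_const.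
apply: ler_sum => k _; apply: ge_sup.
  by exists `|f^`(k) 0|, 0; rewrite //= in_itv/= oppr_le0 ler0n.
move=> _ [x + <-]; rewrite /= in_itv/= -ler_norml => xn.
by apply: fe => //; rewrite -ltnS.
Qed.

Lemma smooth_seminorm_ge0 n f : 0 <= p n f.
Proof.
rewrite (le_trans (normr_ge0 (f^`(0) 0)))// ler_smooth_seminorm//.
by rewrite normr0 ler0n.
Qed.

Lemma smooth_seminormZ n a f : p n (a *: f) = `|a| * p n f.
Proof.
have le b g : p n (b *: g) <= `|b| * p n g.
  rewrite /smooth_seminorm big_distrr/=; apply: ler_sum => k _; apply: ge_sup.
    by exists `|(b *: g)^`(k) 0|, 0; rewrite //= in_itv/= oppr_le0 ler0n.
  move=> _ [x Ix <-]; rewrite derive1n_smoothZ normrM ler_wpM2l//.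
  by apply: ub_le_sup; [case: (has_sup_derive1n g n k)|exists x].
apply/le_anti; rewrite le//=.
have [->|a0] := eqVneq a 0.
  by rewrite normr0 mul0r smooth_seminorm_ge0.
rewrite -[in leLHS](scalerK a0 f) (le_trans (ler_wpM2l _ (le _ _)))//.
by rewrite normfV mulVKf// normr_eq0.
Qed.

Lemma smooth_seminorm_sum n (I : Type) (r : seq I) (P : pred I)
    (F : I -> smoothFun R) :
  p n (\sum_(i <- r | P i) F i) <= \sum_(i <- r | P i) p n (F i).
Proof.
elim/big_rec2 : _ => [|i u v _ uv]; first by rewrite smooth_seminorm0.
by rewrite (le_trans (ler_smooth_seminormD _ _ _))// lerD2l.
Qed.

Lemma smooth_seminormBC n f g : p n (f - g) = p n (g - f).
Proof. by rewrite -smooth_seminormN opprB. Qed.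

Lemma smooth_seminorm_eq0 f : (forall n, p n f = 0) -> f = 0.
Proof.
move=> f0; apply: smooth_ext => x.
have [n xn] : exists n : nat, `|x| <= n%:R.
  by exists (Num.truncn `|x|).+1; rewrite ltW// truncnS_gt.
apply/eqP; rewrite -normr_le0 -(f0 n).
exact: (@ler_smooth_seminorm n f 0%N x).
Qed.

Lemma derive1n_horner (q : {poly R}) k : (horner q)^`(k) = horner (derivn k q).
Proof.
elim: k => [|k IHk]; first by rewrite derivn0.
by rewrite derive1nS IHk derivnS derivE.
Qed.

Lemma smooth_horner (q : {poly R}) : smooth (horner q).
Proof. by move=> k x; rewrite derive1n_horner; exact: derivable_horner. Qed.

Definition smooth_poly (q : {poly R}) : smoothFun R := mkSmooth (@smooth_horner
  q).

Lemma derive1n_smooth_poly q k x : (smooth_poly q)^`(k) x = (derivn k q).[x].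
Proof. by rewrite /= derive1n_horner. Qed.

Lemma derive1n_smooth_poly0 q k : (smooth_poly q)^`(k) 0 = q`_k * k`!%:R.
Proof.
by rewrite derive1n_smooth_poly horner_coef0 coef_derivn addn0 ffactnn
  mulr_natr.
Qed.

End smooth_functions.

(** * Universality and the G-delta property *)

Section weighted_taylor.
Variables (R : realType) (alpha : nat -> nat -> R).
Implicit Types (f g : smoothFun R) (a x : R).
Local Notation p := (@smooth_seminorm R).
Local Notation S := (weighted_taylor alpha).

Lemma weighted_taylorZD n a f g x : S n (a *: f + g) x = a * S n f x + S n g x.
Proof.
rewrite /weighted_taylor big_distrr/= -big_split/=; apply: eq_bigr => k _.
by rewrite derive1n_smoothZD; ring.
Qed.

Lemma weighted_taylorD n f g x : S n (f + g) x = S n f x + S n g x.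
Proof. by rewrite -[in LHS](scale1r f) weighted_taylorZD mul1r. Qed.

Lemma weighted_taylor_eq0 n (f : R -> R) x :
  (forall k, (k <= n)%N -> f^`(k) 0 = 0) -> S n f x = 0.
Proof.
move=> f0; rewrite /weighted_taylor big1// => k _.
by rewrite f0 ?mul0r// -ltnS.
Qed.

Lemma weighted_taylorZ n a f x : S n (a *: f) x = a * S n f x.
Proof.
rewrite -[in LHS](addr0 (a *: f)) weighted_taylorZD [X in _ +
  X]weighted_taylor_eq0 ?addr0//.
by move=> k _; exact: derive1n_smooth0.
Qed.

Lemma weighted_taylorB n f g x : S n (f - g) x = S n f x - S n g x.
Proof. by rewrite addrC -scaleN1r weighted_taylorZD mulN1r addrC. Qed.

Lemma eq_weighted_taylor n (f g : R -> R) x :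
  (forall k, (k <= n)%N -> f^`(k) 0 = g^`(k) 0) -> S n f x = S n g x.
Proof. by move=> fg; apply: eq_bigr => k _; rewrite fg// -ltnS. Qed.

Lemma weighted_taylor_horner n (f : R -> R) x : S n f x =
  ('X * \poly_(k < n.+1) (f^`(k) 0 / k`!%:R * alpha n k)).[x].
Proof.
rewrite hornerM hornerX horner_poly mulr_sumr; apply: eq_bigr => k _.
by rewrite exprS; ring.
Qed.

Lemma weighted_taylor_continuous n (f : R -> R) : continuous (S n f).
Proof.
have -> : S n f =
    horner ('X * \poly_(k < n.+1) (f^`(k) 0 / k`!%:R * alpha n k)).
  by apply/funext => x; exact: weighted_taylor_horner.
exact: continuous_horner.
Qed.

(** Derivatives at 0 up to order [n] are controlled by [p n], so a partial sum depends continuously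
    on [f], uniformly on [[- M, M]]. This gives the openness in the G-delta statement. *)
Lemma weighted_taylor_le n (M : R) : exists2 C, 0 < C &
  forall f x, `|x| <= M -> `|S n f x| <= C * p n f.
Proof.
pose C := \sum_(k < n.+1) `|alpha n k| * `|M| ^+ k.+1.
have C0 : 0 <= C by apply: sumr_ge0 => k _; rewrite mulr_ge0// exprn_ge0.
exists (C + 1) => [|f x xM]; first by rewrite ltr_wpDl.
apply: (@le_trans _ _ (C * p n f)); last first.
  by rewrite ler_wpM2r ?smooth_seminorm_ge0// lerDl.
rewrite (le_trans (ler_norm_sum _ _ _))// /C mulr_suml.
apply: ler_sum => k _; rewrite !normrM normrX [leRHS]mulrC mulrA.
rewrite ler_pM ?mulr_ge0 ?exprn_ge0 ?normr_ge0//; last first.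
  by rewrite lerXn2r ?nnegrE// (le_trans xM)// ler_norm.
rewrite ler_wpM2r// normfV ler_pdivrMr; last first.
  by rewrite normr_gt0 pnatr_eq0 -lt0n fact_gt0.
rewrite (@le_trans _ _ (p n f))//.
  by rewrite ler_smooth_seminorm ?normr0 ?ler0n// -ltnS.
by rewrite ler_peMr ?smooth_seminorm_ge0// ger0_norm// ler1n fact_gt0.
Qed.

End weighted_taylor.

Section universality_criterion.
Variables (R : realType) (alpha : nat -> nat -> R) (mu : nat -> nat).
Hypothesis mu_increasing : increasing_seq mu.
Local Notation S := (weighted_taylor alpha).

Lemma increasing_seq_ge (u : nat -> nat) : increasing_seq u ->
  forall n, (n <= u n)%N.
Proof.
move=> u_incr; elim=> // n IHn; rewrite (leq_ltn_trans IHn)//.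
exact: (increasing_seqP _).2 u_incr n.
Qed.

(** Compact sets and sequences are traded for one integer [s], which serves at once as radius,
    accuracy and lower bound on the index. *)
Lemma universal_seriesP (f : R -> R) : universal_series alpha mu f <->
  forall h : R -> R, continuous h -> h 0 = 0 -> forall s : nat,
    exists2 i, (s <= i)%N &
      forall x, `|x| <= s%:R -> `|S (mu i) f x - h x| <= s.+1%:R^-1.
Proof.
split=> [Uf h ch h0 s|Uf h ch h0 K cK].
  have cK : compact `[- s%:R : R, s%:R] by exact: segment_compact.
  have [l [l_incr l_mu /cvgrPdist_le/(_ s.+1%:R^-1)]] := Uf h ch h0 _ cK.
  rewrite invr_gt0// => /(_ (ltr0Sn _ _))[N _ NP].
  (* Beyond [N] the error is small, and [l n >= n >= mu s] forces the index [i] with [mu i = l n] to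
     be at least [s]. *)
  set n := maxn N (mu s).
  have [i _ il] : range mu (l n) by apply: l_mu; exists n.
  exists i.
    rewrite -mu_increasing il leEnat (leq_trans _ (increasing_seq_ge l_incr
      n))//.
    exact: leq_maxr.
  move=> x xs; rewrite il.
  have := NP n (leq_maxl _ _); rewrite sub0r normrN; apply: le_trans.
  rewrite (le_trans _ (ler_norm _))//; apply: ub_le_sup; last first.
    by exists x => //=; rewrite in_itv/= -ler_norml.
  have [||] := @compact_has_sup R
    [set `|S (l n) f x - h x| | x in `[- s%:R : R, s%:R]] => //.
    by exists `|S (l n) f 0 - h 0|, 0; rewrite //= in_itv/= oppr_le0 ler0n.
  apply: continuous_compact; last exact: cK.
  apply: continuous_subspaceT => y; apply: cvg_norm; apply: cvgB.
    exact: weighted_taylor_continuous.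
  exact: ch.
have [M KM] : exists M : nat, forall x, K x -> `|x| <= M%:R.
  have [B [_ BP]] := compact_bounded cK.
  exists (Num.truncn (B + 1)).+1 => x Kx.
  by rewrite (le_trans (BP (B + 1) _ x Kx)) ?ltrDl// ltW// truncnS_gt.
have /choice[c cP] : forall s : nat, exists i, (s <= i)%N /\
    forall x, `|x| <= s%:R -> `|S (mu i) f x - h x| <= s.+1%:R^-1.
  by move=> s; have [i] := Uf h ch h0 s; exists i.
(* Since [c s >= s], feeding [(j n + M).+1] back into [c] makes [j] strictly increasing. The
   arguments given to [c] stay at least [M], so that [K] is covered, and grow with [n], so that the
   error tends to 0. *)
pose j := fix j n := if n is n'.+1 then c (j n' + M).+1 else c M.
have j_incr n : (j n < j n.+1)%N.
  by rewrite /= (leq_trans _ (cP _).1)// ltnS leq_addr.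
have jn n : exists s : nat, [/\ (n <= s)%N, (M <= s)%N & j n = c s].
  case: n => [|n]; first by exists M.
  exists (j n + M).+1; split=> //; last by rewrite ltnW// ltnS leq_addl.
  rewrite ltnS (@leq_trans (j n))// ?leq_addr//.
  elim: n => // n IHn; exact: leq_ltn_trans (j_incr n).
exists (mu \o j); split.
- by apply/increasing_seqP => n /=; rewrite ltEnat/= (leqW_mono mu_increasing).
- by move=> _ [n _ <-]; exists (j n).
apply/cvgrPdist_le => e e0.
have [N NP] := invSn_lt e0.
exists N => // n /= Nn; rewrite sub0r normrN.
have bnd x : K x -> `|S (mu (j n)) f x - h x| <= e.
  have [s [ns Ms ->]] := jn n => Kx.
  have /= := (cP s).2 x; rewrite (le_trans (KM _ Kx)) ?ler_nat// => /(_ isT).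
  by move=> /le_trans; apply; rewrite ltW// NP// (leq_trans Nn).
have [->|/set0P[y Ky]] := eqVneq K set0; first by rewrite image_set0 sup0
  normr0 ltW.
rewrite ger0_norm.
  apply: ge_sup; first by exists `|S (mu (j n)) f y - h y|, y.
  by move=> _ [x Kx <-]; exact: bnd.
apply: le_trans (normr_ge0 (S (mu (j n)) f y - h y)) _.
apply: ub_le_sup; last by exists y.
by exists e => _ [x Kx <-]; exact: bnd.
Qed.

End universality_criterion.

Section universality.
Variables (R : realType) (alpha : nat -> nat -> R) (mu : nat -> nat).
Hypothesis mu_increasing : increasing_seq mu.
Implicit Types (f g y : smoothFun R) (x : R).
Local Notation S := (weighted_taylor alpha).
Local Notation p := (@smooth_seminorm R).

Definition rat_target (q : {poly rat}) : R -> R :=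
  horner ('X * map_poly ratr q).

Lemma rat_target_continuous q : continuous (rat_target q).
Proof. exact: continuous_horner. Qed.

Lemma rat_target0 q : rat_target q 0 = 0.
Proof. by rewrite /rat_target hornerM hornerX mul0r. Qed.

Lemma rat_target_dense (h : R -> R) (M e : R) : continuous h -> h 0 = 0 ->
  0 < e -> exists q, forall x, `|x| <= M -> `|h x - rat_target q x| <= e.
Proof.
move=> ch h0 e0; have e20 : 0 < e / 2 by rewrite divr_gt0.
have [r rP] := flat_weierstrass 1 M ch h0 e20.
have M0 : 0 < `|M| + 1 by rewrite ltr_wpDl.
have [|q qP] := @rat_poly_approx R r M (e / 2 / (`|M| + 1)).
  by rewrite !divr_gt0.
exists q => x xM; rewrite -(subrK ('X^1 * r).[x] (h x)) -addrA.
rewrite (le_trans (ler_normD _ _))// [leRHS]splitr lerD ?rP//.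
rewrite /rat_target expr1 !hornerM hornerX -mulrBr normrM.
rewrite (le_trans (ler_wpM2l _ (qP _ xM)))//.
by apply: mulr_div1p_le; rewrite ?(ltW e20)// (le_trans xM)// ler_norm.
Qed.

Lemma invSn_halve s : s.+1%:R^-1 = (s.+1.*2)%:R^-1 + (s.+1.*2)%:R^-1 :> R.
Proof.
rewrite -mul2n natrM; have : s.+1%:R != 0 :> R by [].
by move: (s.+1%:R) => t t0; field.
Qed.

Lemma universal_series_ratP (f : R -> R) : universal_series alpha mu f <->
  forall q (s : nat), exists2 i, (s <= i)%N &
    forall x, `|x| <= s%:R -> `|S (mu i) f x - rat_target q x| <= s.+1%:R^-1.
Proof.
split=> [/(universal_seriesP _ mu_increasing) Uf q s|Uf].
  by apply: Uf; [exact: rat_target_continuous|exact: rat_target0].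
apply/(universal_seriesP _ mu_increasing) => h ch h0 s.
have e0 : 0 < (s.+1.*2)%:R^-1 :> R by rewrite invr_gt0 ltr0n double_gt0.
have [q qP] := rat_target_dense s%:R ch h0 e0.
(* The predecessor makes the accuracy exactly the inverse of [s.+1.*2], one half of the tolerance;
   the other half goes to the approximation of [h] by the target of [q]. *)
have [i si iP] := Uf q s.+1.*2.-1.
have ss : (s <= s.+1.*2.-1)%N by rewrite doubleS/= -addnn -addnS leq_addr.
exists i => [|x xs]; first exact: leq_trans si.
rewrite -(subrK (rat_target q x) (S _ _ _)) -addrA (le_trans (ler_normD _ _))//.
rewrite invSn_halve lerD//; last by rewrite distrC qP.
rewrite (le_trans (iP _ _)) ?prednK ?double_gt0//.
by rewrite (le_trans xs)// ler_nat.
Qed.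

(** By density of the rational targets, universality is a countable conjunction of conditions. Each
    one asks for some partial sum, hence for finitely many derivatives at 0, to be close to a
    target; the strict inequality on [e] makes it open. *)
Lemma Gdelta_universal_smooth : Gdelta (universal_smooth alpha mu).
Proof.
pose O (qs : {poly rat} * nat) := [set f : smoothFun R |
  exists i e, [/\ (qs.2 <= i)%N, e < qs.2.+1%:R^-1 & forall x, `|x| <= qs.2%:R
    ->
    `|S (mu i) f x - rat_target qs.1 x| <= e]].
exists (fun n => if unpickle n is Some qs then O qs else setT) => [n|].
  case: unpickle => [[q s]|]; last exact: openT.
  rewrite openE => f /= [i [e [si es eP]]].
  have [C C0 CP] := weighted_taylor_le alpha (mu i) s%:R.
  apply/nbhs_smoothP; exists (mu i), ((s.+1%:R^-1 - e) / 2 / C).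
  have se : 0 < (s.+1%:R^-1 - e) / 2 by rewrite divr_gt0// subr_gt0.
  split; first by rewrite divr_gt0.
  move=> g /= fg; exists i, ((s.+1%:R^-1 + e) / 2); split=> //= [|x xs].
    by move: es => /=; move: (_^-1) => t; lra.
  have : `|S (mu i) g x - S (mu i) f x| <= (s.+1%:R^-1 - e) / 2.
    rewrite -weighted_taylorB (le_trans (CP _ _ xs))// smooth_seminormBC.
    by rewrite -ler_pdivlMl// mulrC ltW.
  have := eP _ xs; rewrite !ler_norml; move: (_^-1) => t; lra.
apply/seteqP; split=> [f /universal_series_ratP Uf n _|f Uf].
  case: unpickle => [[q s]|//].
  (* Using the criterion at [s.+1] instead of [s] yields the strict inequality. *)
  have [i si iP] := Uf q s.+1; exists i, s.+2%:R^-1; split=> /=.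
  - exact: ltnW.
  - by rewrite ltf_pV2 ?posrE// ltr_nat.
  - by move=> x xs; apply: iP; rewrite (le_trans xs)// ler_nat.
apply/universal_series_ratP => q s.
have := Uf (pickle (q, s)) I; rewrite pickleK => -[i [e [/= si es eP]]].
by exists i => // x /eP/le_trans; apply; exact: ltW.
Qed.

Hypothesis alpha_cvg : forall k, cvg (alpha n k @[n --> \oo]).

(** Here the convergence of each column [alpha n k] in [n] enters: a fixed number of terms tends,
    uniformly on bounded sets, to a polynomial limit [L]. *)
Lemma weighted_prefix_cvg (c : nat -> R) d : exists L : R -> R,
  [/\ continuous L, L 0 = 0 & forall M e, 0 < e -> exists N, forall n x,
    (N <= n)%N -> `|x| <= M ->
    `|\sum_(k < d) c k * alpha n k * x ^+ k.+1 - L x| <= e].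
Proof.
elim: d => [|d [L [cL L0 LP]]].
  exists (fun=> 0); split=> // [x|M e e0]; first exact: cvg_cst.
  by exists 0%N => n x _ _; rewrite big_ord0 subrr normr0 ltW.
pose a := lim (alpha n d @[n --> \oo]).
exists (fun x => L x + c d * a * x ^+ d.+1); split=> [x||M e e0].
- apply: cvgD; first exact: cL.
  by apply: cvgM; [exact: cvg_cst|exact: exprn_continuous].
- by rewrite L0 expr0n mulr0 addr0.
have e20 : 0 < e / 2 by rewrite divr_gt0.
have [N1 N1P] := LP M _ e20.
pose w := `|c d| * `|M| ^+ d.+1.
have w0 : 0 <= w by rewrite mulr_ge0// exprn_ge0.
have /cvgrPdist_le/(_ (e / 2 / (w + 1))) := alpha_cvg (k := d).
rewrite -/a divr_gt0 ?ltr_wpDl// => /(_ isT)[N2 _ N2P].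
exists (maxn N1 N2) => n x; rewrite geq_max => /andP[n1 n2] xM.
rewrite big_ord_recr/=.
have -> (s b u v z : R) : s + b * u * z - (v + b * a * z) = (s - v) + b * z *
  (u - a) by ring.
rewrite (le_trans (ler_normD _ _))// [leRHS]splitr lerD ?N1P//.
have := N2P _ n2; rewrite distrC => an.
rewrite normrM (le_trans (ler_wpM2l _ an))//; apply: mulr_div1p_le => //.
  exact: ltW.
rewrite normrM normrX ler_wpM2l// lerXn2r ?nnegrE// (le_trans xM)//.
exact: ler_norm.
Qed.

(** Only the orders below [d] of [y] contribute, so its partial sums tend to a limit [L]; aiming at
    [h] with [f + y] amounts to aiming at [h - L] with [f]. *)
Lemma universal_seriesD f y d : (forall k, (d <= k)%N -> y^`(k) 0 = 0) ->
  universal_series alpha mu f -> universal_series alpha mu (f + y).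
Proof.
move=> yd /(universal_seriesP _ mu_increasing) Uf.
apply/(universal_seriesP _ mu_increasing) => h ch h0 s.
have [L [cL L0 LP]] := weighted_prefix_cvg (fun k => y^`(k) 0 / k`!%:R) d.
have e0 : 0 < (s.+1.*2)%:R^-1 :> R by rewrite invr_gt0 ltr0n double_gt0.
have [N NP] := LP s%:R _ e0.
have [||i si iP] := Uf (fun x => h x - L x) _ _ (maxn s.+1.*2.-1 (maxn N d)).
- by move=> x; apply: cvgB; [exact: ch|exact: cL].
- by rewrite h0 L0 subr0.
have := si; rewrite !geq_max => /and3P[si1 Ni di].
have ss : (s <= s.+1.*2.-1)%N by rewrite doubleS/= -addnn -addnS leq_addr.
have mui := increasing_seq_ge mu_increasing i.
exists i => [|x xs]; first exact: leq_trans si1.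
rewrite weighted_taylorD.
have -> : S (mu i) y x =
    \sum_(k < d) y^`(k) 0 / k`!%:R * alpha (mu i) k * x ^+ k.+1.
  rewrite /weighted_taylor.
  rewrite (big_ord_widen _ (fun k => y^`(k) 0 / k`!%:R * alpha (mu i) k * x ^+
    k.+1)
    (leqW (leq_trans di mui))) [RHS]big_mkcond/=.
  by apply: eq_bigr => k _; case: ltnP => // dk; rewrite yd// !mul0r.
have split_diff (u v w z : R) : u + v - w = (u - (w - z)) + (v - z) by ring.
rewrite (split_diff _ _ _ (L x)) (le_trans (ler_normD _ _))// invSn_halve
  lerD//; last first.
  by apply: NP => //; rewrite (leq_trans Ni).
rewrite (le_trans (iP _ _))//.
  by rewrite (le_trans xs)// ler_nat !leq_max ss.
by rewrite lef_pV2 ?posrE ?ltr0n// ler_nat -[leqLHS]prednK ?double_gt0// ltnS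
  leq_maxl.
Qed.

End universality.

(** * Prescribing derivatives at 0 by small functions *)

Section interpolation.
Variable R : realType.
Implicit Types (f g : smoothFun R) (t a b x : R).
Local Notation p := (@smooth_seminorm R).

Definition trig t a b x : R := a * sin (t * x) + b * cos (t * x).

Fixpoint trig_coefs a b k : R * R :=
  if k is k'.+1 then (- (trig_coefs a b k').2, (trig_coefs a b k').1)
  else (a, b).

Lemma is_derive_trig t a b x :
  is_derive x 1 (trig t a b) (t * trig t (- b) a x).
Proof.
apply: trigger_derive; rewrite /trig /GRing.scale/=; ring.
Qed.

Lemma derive1n_trig t a b k : (trig t a b)^`(k) =
  (fun x => t ^+ k * trig t (trig_coefs a b k).1 (trig_coefs a b k).2 x).
Proof.
elim: k => [|k IHk]; first by apply/funext => x; rewrite mul1r.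
rewrite derive1nS IHk; apply/funext => x; rewrite derive1E.
have := is_derive_trig t (trig_coefs a b k).1 (trig_coefs a b k).2 x.
move=> dt; rewrite -[X in 'D_1 X x]/(t ^+ k *: trig t _ _).
by rewrite deriveZ//= derive_val exprSr -[LHS]/(_ * _) mulrA.
Qed.

Lemma smooth_trig t a b : smooth (trig t a b).
Proof.
move=> k x; rewrite derive1n_trig.
have dt := is_derive_trig t (trig_coefs a b k).1 (trig_coefs a b k).2 x.
exact: (@derivableZ _ _ _ (trig t _ _)).
Qed.

(** Starting from [sin + cos] keeps both coefficients equal to 1 in absolute value, so that no
    derivative vanishes at 0, whatever its order. *)
Lemma trig_coefs1 k :
  `|(trig_coefs 1 1 k).1| = 1 /\ `|(trig_coefs 1 1 k).2| = 1.
Proof.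
by elim: k => [|k [IH1 IH2]] /=; rewrite ?normr1// normrN.
Qed.

Lemma trig_le2 t a b x : `|a| = 1 -> `|b| = 1 -> `|trig t a b x| <= 2.
Proof.
move=> a1 b1; rewrite (le_trans (ler_normD _ _))// !normrM a1 b1 !mul1r.
rewrite (_ : 2 = 1 + 1)// lerD// ler_norml ?sin_geN1 ?sin_le1 ?cos_geN1
  ?cos_le1//.
Qed.

(* A rapidly oscillating trigonometric function, from which its Taylor
   polynomial of degree [N] is removed. *)
Lemma small_flat_smooth N (e : R) : 0 < e -> exists v : smoothFun R, [/\
  forall k, (k <= N)%N -> v^`(k) 0 = 0, v^`(N.+1) 0 = 1 & p N v < e].
Proof.
move=> e0.
pose C := \sum_(j < N.+1) p N (smooth_poly 'X^j).
have C0 : 0 <= C by apply: sumr_ge0 => j _; exact: smooth_seminorm_ge0.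
(* The Taylor coefficients of [w] are at most [p N w], so removing them gives
   [p N v <= p N w * (1 + C)], while [p N w <= N.+1 * (2 / t)]. This frequency brings the product
   below [e]; the summand 1 makes [t > 1] and the inequality strict. *)
pose t := 1 + N.+1%:R * 2 * (1 + C) / e.
have t1 : 1 < t by rewrite ltrDl divr_gt0// mulr_gt0// ltr_wpDr.
have t0 : 0 < t by rewrite (lt_trans _ t1).
pose s := (trig_coefs 1 1 N.+1).2.
have s1 : `|s| = 1 by have [] := trig_coefs1 N.+1.
have s0 : s != 0 by rewrite -normr_eq0 s1 oner_eq0.
pose w : smoothFun R := (s * t ^+ N.+1)^-1 *: mkSmooth (@smooth_trig t 1 1).
have wE k x : w^`(k) x = (s * t ^+ N.+1)^-1 *
    (t ^+ k * trig t (trig_coefs 1 1 k).1 (trig_coefs 1 1 k).2 x).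
  by rewrite /w derive1n_smoothZ/= derive1n_trig.
have wN : p N w <= N.+1%:R * (2 / t).
  apply: smooth_seminorm_le => k x kN _; have [c1 c2] := trig_coefs1 k.
  rewrite wE normrM normfV normrM s1 mul1r normrM !normrX (gtr0_norm t0).
  rewrite mulrA [leRHS]mulrC ler_pM ?mulr_ge0 ?invr_ge0 ?exprn_ge0 ?(ltW t0)//.
    rewrite exprS invfM -mulrA ler_piMr ?invr_ge0 ?(ltW t0)//.
    rewrite mulrC ler_pdivrMr ?exprn_gt0// mul1r ler_weXn2l// ltW//.
  exact: trig_le2.
pose v := w - \sum_(j < N.+1) (w^`(j) 0 / j`!%:R) *: smooth_poly 'X^j.
have vE k : v^`(k) 0 = w^`(k) 0 - (if (k <= N)%N then w^`(k) 0 else 0).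
  rewrite /v derive1n_smoothB derive1n_smooth_sum; congr (_ - _).
  under eq_bigr => j _ do rewrite derive1n_smoothZ derive1n_smooth_poly0 coefXn.
  case: ifPn => [kN|]; last first.
    rewrite -ltnNge => Nk; rewrite big1// => j _.
    by rewrite gtn_eqF ?mul0r ?mulr0// (leq_trans (ltn_ord j)).
  have kN1 : (k < N.+1)%N by [].
  rewrite (bigD1 (Ordinal kN1))//= eqxx mul1r divfK ?pnatr_eq0 -?lt0n
    ?fact_gt0//.
  rewrite big1 ?addr0// => j jk; rewrite eq_sym (negbTE (_ : nat_of_ord j !=
    k)) ?mul0r ?mulr0//.
exists v; split=> [k kN||].
- by rewrite vE kN subrr.
- rewrite vE ltnn subr0 wE /trig mulr0 sin0 cos0 mulr0 add0r mulr1 -/s.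
  by rewrite [_ * s]mulrC mulVf// mulf_neq0// expf_neq0// gt_eqF.
have pv : p N v <= p N w * (1 + C).
  rewrite (le_trans (ler_smooth_seminormD _ _ _))// smooth_seminormN mulrDr
    mulr1.
  rewrite lerD2l (le_trans (smooth_seminorm_sum _ _ _ _))// /C mulr_sumr.
  apply: ler_sum => j _; rewrite smooth_seminormZ ler_wpM2r
    ?smooth_seminorm_ge0//.
  rewrite normrM normfV ler_pdivrMr ?normr_gt0 ?pnatr_eq0 -?lt0n ?fact_gt0//.
  rewrite (@le_trans _ _ (p N w))//.
    by rewrite ler_smooth_seminorm ?normr0 ?ler0n// -ltnS.
  by rewrite ler_peMr ?smooth_seminorm_ge0// ger0_norm// ler1n fact_gt0.
rewrite (le_lt_trans pv)//.
rewrite (le_lt_trans (ler_wpM2r _ wN)) ?addr_ge0//.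
have -> : N.+1%:R * (2 / t) * (1 + C) = N.+1%:R * 2 * (1 + C) / t by ring.
rewrite ltr_pdivrMr//.
have -> : e * t = e + N.+1%:R * 2 * (1 + C).
  by rewrite /t mulrDr mulr1 mulrCA mulfV ?mulr1// gt_eqF.
by rewrite ltrDr.
Qed.

(* Prescribing the derivatives at 0 one order at a time, each correction being
   flat up to the previous orders. *)
Lemma interpolation N m (d : nat -> R) (e : R) : 0 < e -> exists b : smoothFun
  R, [/\
  forall k, (k <= N)%N -> b^`(k) 0 = 0,
  forall k, (N < k <= m)%N -> b^`(k) 0 = d k & p N b < e].
Proof.
move=> e0; elim: m => [|m [b [bN bd be]]].
  exists 0; split=> [k _|k|]; first exact: derive1n_smooth0.
    by case/andP => /leq_trans h/h.
  by rewrite smooth_seminorm0.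
have [mN|Nm] := leqP m.+1 N.
  exists b; split=> // k /andP[Nk km].
  by have := leq_trans Nk km; rewrite ltnNge mN.
pose c := d m.+1 - b^`(m.+1) 0.
have [|v [v0 v1 ve]] := @small_flat_smooth m ((e - p N b) / (`|c| + 1)).
  by rewrite divr_gt0 ?subr_gt0// ltr_wpDl.
exists (b + c *: v); split=> [k kN|k /andP[Nk]|].
- by rewrite derive1n_smoothD derive1n_smoothZ bN// v0 ?mulr0 ?addr0//
  (leq_trans kN).
- rewrite leq_eqVlt => /predU1P[->|km].
    by rewrite derive1n_smoothD derive1n_smoothZ v1 mulr1 addrC subrK.
  by rewrite derive1n_smoothD derive1n_smoothZ v0 ?mulr0 ?addr0 ?bd ?Nk.
rewrite (le_lt_trans (ler_smooth_seminormD _ _ _))// smooth_seminormZ -ltrBrDl.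
rewrite (le_lt_trans (ler_wpM2l _ (le_smooth_seminorm _ (Nm : (N <= m)%N))))//.
have [->|c0] := eqVneq c 0; first by rewrite normr0 mul0r subr_gt0.
rewrite -ltr_pdivlMl ?normr_gt0// (lt_le_trans ve)// mulrC ler_pM2r ?subr_gt0//.
  by rewrite lef_pV2 ?posrE ?normr_gt0 ?ltr_wpDl// lerDl.
Qed.

End interpolation.

Section approximation_step.
Variables (R : realType) (alpha : nat -> nat -> R).
Hypothesis alpha_neq0 : forall n k, (k <= n)%N -> alpha n k != 0.
Hypothesis alpha_cvg : forall k, cvg (alpha n k @[n --> \oo]).
Local Notation S := (weighted_taylor alpha).
Local Notation p := (@smooth_seminorm R).

(** The orders up to [K] of [F] contribute almost [L], and a polynomial [P] flat at 0 approximates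
    [h - L]; the derivatives of order above [K] are then chosen so that the remaining terms add up
    to [P]. Every large [m] is allowed, which lets finitely many functions share the same partial
    sum. *)
Lemma approximation_step (F : smoothFun R) K (h : R -> R) (M e : R) :
  continuous h -> h 0 = 0 -> 0 < e ->
  exists m0, forall m, (m0 <= m)%N -> exists b : smoothFun R, [/\
    forall k, (k <= K)%N -> b^`(k) 0 = 0, p K b < e &
    forall x, `|x| <= M -> `|S m (F + b) x - h x| <= e].
Proof.
move=> ch h0 e0; have e20 : 0 < e / 2 by rewrite divr_gt0.
pose c k := F^`(k) 0 / k`!%:R.
have [L [cL L0 LP]] := weighted_prefix_cvg alpha_cvg c K.+1.
have [N NP] := LP M _ e20.
have [||q qP] := @flat_weierstrass R (fun x => h x - L x) K.+2 M _ _ _ e20.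
- by move=> x; apply: cvgB; [exact: ch|exact: cL].
- by rewrite h0 L0 subr0.
set P := 'X^(K.+2) * q in qP.
have P0 j : (j <= K.+1)%N -> P`_j = 0 by move=> jK; rewrite /P coefXnM ltnS jK.
exists (maxn N (maxn K (size P))) => m; rewrite !geq_max => /and3P[Nm Km Pm].
(* Dividing by [alpha m k] makes the term of order [k] equal to the monomial of degree [k.+1] of
   [P]; the shift by one comes from the factor [x ^+ k.+1]. *)
pose d k := P`_k.+1 / alpha m k * k`!%:R - F^`(k) 0.
have [b [b0 bd be]] := interpolation K m d e0.
exists b; split=> // x xM.
have -> : S m (F + b) x = \sum_(k < K.+1) c k * alpha m k * x ^+ k.+1 + P.[x].
  rewrite (@horner_coef_wide _ m.+2 P); last exact: leqW (leqW Pm).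
  rewrite [X in _ = _ + X]big_ord_recl P0// mul0r add0r.
  rewrite (big_ord_widen m.+1 (fun k => c k * alpha m k * x ^+ k.+1))//.
  rewrite [X in _ = X + _]big_mkcond -big_split/=; apply: eq_bigr => k _.
  rewrite derive1n_smoothD ltnS /bump/= add1n; case: leqP => [kK|Kk].
    by rewrite b0// addr0 P0// mul0r addr0.
  have km : (k <= m)%N by rewrite -ltnS.
  have k0 : k`!%:R != 0 :> R by rewrite pnatr_eq0 -lt0n fact_gt0.
  rewrite (bd k) ?Kk// /d [_ + (_ - _)]addrC subrK (mulfK k0) add0r.
  by rewrite divfK// alpha_neq0.
have -> : \sum_(k < K.+1) c k * alpha m k * x ^+ k.+1 + P.[x] - h x =
  (\sum_(k < K.+1) c k * alpha m k * x ^+ k.+1 - L x) - (h x - L x - P.[x]).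
  by ring.
by rewrite (le_trans (ler_normB _ _))// [leRHS]splitr lerD ?NP ?qP.
Qed.

End approximation_step.

(** * Completeness: summing series of smooth functions *)

Section completeness.
Variable R : realType.
Local Notation p := (@smooth_seminorm R).

Lemma derive1n_mvt (f : smoothFun R) k (B M x y : R) :
  (forall z, `|z| <= M -> `|f^`(k.+1) z| <= B) -> `|x| <= M -> `|y| <= M ->
  `|f^`(k) y - f^`(k) x| <= B * `|y - x|.
Proof.
move=> fB; wlog xy : x y / x <= y.
  move=> wl xM yM; have [xy|/ltW yx] := leP x y; first exact: wl.
  by rewrite (distrC (f^`(k) y)) (distrC y); exact: wl.
rewrite !(ler_norml _ M) => /andP[x1 x2] /andP[y1 y2].
have [||z] := @MVT_segment R (f^`(k)) (f^`(k.+1)) x y xy.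
- by move=> z _; exact: is_derive_derive1n.
- by apply: continuous_subspaceT; exact: continuous_derive1n.
rewrite in_itv/= => /andP[xz zy] ->; rewrite normrM ler_wpM2r//.
by apply: fB; rewrite ler_norml (le_trans x1)// (le_trans zy).
Qed.

Lemma derive1n_lipschitz (f : smoothFun R) k n x y : `|x| <= n%:R ->
  `|y| <= n%:R -> (k < n)%N -> `|f^`(k) y - f^`(k) x| <= p n f * `|y - x|.
Proof.
move=> xn yn kn; apply: (@derive1n_mvt _ _ _ n%:R) => // z zn.
exact: ler_smooth_seminorm.
Qed.

Lemma is_derive1P (f : R -> R) (x l : R) : is_derive x 1 f l <->
  forall e, 0 < e -> exists2 d, 0 < d &
    forall h, h != 0 -> `|h| < d -> `|h^-1 * (f (h + x) - f x) - l| <= e.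
Proof.
split=> [dfx e e0|fl].
  have [dx <-] := dfx.
  have /cvgrPdist_le/(_ e e0) := dx.
  rewrite -nbhs_nearE => -[d /= d0 dP]; exists d => // h h0 hd.
  have := dP h; rewrite /= sub0r normrN distrC -[h%:A]/(h * 1) mulr1.
  by apply.
have cfl : h^-1 *: ((f \o shift x) (h *: 1) - f x) @[h --> 0^'] --> l.
  apply/cvgrPdist_le => e /fl[d d0 dP].
  exists d => //= h; rewrite /= sub0r normrN => hd h0.
  by rewrite distrC -[h%:A]/(h * 1) mulr1; exact: dP.
by apply: DeriveDef; [apply: cvgP cfl|exact: cvg_lim cfl].
Qed.

Lemma geometric_cvg (a : nat -> R) N :
  (forall m m', (N <= m <= m')%N -> `|a m' - a m| <= 2 / 2 ^+ m) ->
  cvg (a n @[n --> \oo]) /\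
  forall m, (N <= m)%N -> `|lim (a n @[n --> \oo]) - a m| <= 2 / 2 ^+ m.
Proof.
move=> aP.
have ca : cvg (a n @[n --> \oo]).
  apply: cauchy_cvg; apply: cauchy_exP => e e0.
  have [|M MP] := @invSn_lt R (e / 2); first by rewrite divr_gt0.
  exists (a (maxn N M)); exists (maxn N M) => // n /= Mn.
  rewrite /ball/= distrC (le_lt_trans (aP _ _ _)) ?leq_maxl//.
  rewrite mulrC -ltr_pdivlMr// (le_lt_trans _ (MP _ (leq_maxr N M)))//.
  rewrite lef_pV2 ?posrE ?exprn_gt0// -natrX ler_nat.
  exact: ltn_expl.
split=> // m Nm; rewrite distrC ler_distlC.
by apply/andP; split; [apply: limr_ge => //|apply: limr_le => //];
  exists m => // n /= mn; have := aP m n; rewrite Nm mn => /(_ isT);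
  rewrite ler_norml; lra.
Qed.

Variable u : nat -> smoothFun R.
Hypothesis u_le : forall i, p i (u i) <= (2 ^+ i)^-1.

Let s m := \sum_(i < m) u i.

Let s_tail n m m' : (n <= m <= m')%N ->
  p n (s m' - s m) <= 2 / 2 ^+ m - 2 / 2 ^+ m'.
Proof.
case/andP=> nm; elim: m' => [|m' IHm].
  by rewrite leqn0 => /eqP ->; rewrite !subrr smooth_seminorm0.
rewrite leq_eqVlt => /predU1P[->|mm']; first by rewrite !subrr smooth_seminorm0.
rewrite /s big_ord_recr/= -/(s m') addrAC (le_trans (ler_smooth_seminormD _ _
  _))//.
have := IHm mm'.
have := le_trans (le_smooth_seminorm _ (leq_trans nm mm')) (u_le m').
rewrite [2 ^+ m'.+1]exprS invfM mulrA mulfV// mul1r; lra.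
Qed.

Let U k (x : R) : R := lim ((s m)^`(k) x @[m --> \oo]).

Let U_cvg n k x m : (k <= n)%N -> `|x| <= n%:R -> (n <= m)%N ->
  cvg ((s m)^`(k) x @[m --> \oo]) /\ `|U k x - (s m)^`(k) x| <= 2 / 2 ^+ m.
Proof.
move=> kn xn nm; have [|cs sP] := @geometric_cvg (fun m => (s m)^`(k) x) n.
  move=> {nm} m m' /andP[nm mm']; rewrite -derive1n_smoothB.
  rewrite (le_trans (ler_smooth_seminorm _ kn xn))//.
  by rewrite (le_trans (s_tail _)) ?nm// gerBl divr_ge0// exprn_ge0.
by split; [exact: cs|exact: sP].
Qed.

Let U_lipschitz n k x y m : (k < n)%N -> `|x| <= n%:R -> `|y| <= n%:R ->
  (n <= m)%N ->
  `|(U k y - (s m)^`(k) y) - (U k x - (s m)^`(k) x)| <= 2 / 2 ^+ m * `|y - x|.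
Proof.
move=> kn xn yn nm.
have [cx _] := U_cvg (ltnW kn) xn nm; have [cy _] := U_cvg (ltnW kn) yn nm.
set b := _ * _.
have cU : (s m')^`(k) y - (s m)^`(k) y - ((s m')^`(k) x - (s m)^`(k) x)
  @[m' --> \oo] --> (U k y - (s m)^`(k) y) - (U k x - (s m)^`(k) x).
  by apply: cvgB; apply: cvgB => //; exact: cvg_cst.
rewrite -(cvg_lim _ (cvg_norm cU))//; apply: limr_le.
  by apply: cvgP; exact: cvg_norm cU.
exists m => // m' /= mm'; rewrite -!derive1n_smoothB.
rewrite (le_trans (derive1n_lipschitz _ xn yn kn))// ler_wpM2r//.
by rewrite (le_trans (s_tail _)) ?nm// gerBl divr_ge0// exprn_ge0.
Qed.

(** The difference quotients of [U k] and of the partial sum [s m] differ by at most the Lipschitz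
    constant of [U_lipschitz], whatever the increment, so [m] can be fixed before the increment
    tends to 0. *)
Let is_derive_U k (x : R) : is_derive x 1 (U k) (U k.+1 x).
Proof.
apply/is_derive1P => e e0.
have e30 : 0 < e / 3 by rewrite divr_gt0.
have [n [kn xn]] : exists n, (k < n)%N /\ `|x| + 1 <= n%:R.
  exists (maxn k.+1 (Num.truncn (`|x| + 1)).+1); rewrite leq_max leqnn; split=>
    //.
  by rewrite (le_trans (ltW (truncnS_gt _)))// ler_nat leq_maxr.
have [|M MP] := @invSn_lt R (e / 3 / 2); first by rewrite divr_gt0.
pose m := maxn n M.
have nm : (n <= m)%N by exact: leq_maxl.
have me : 2 / 2 ^+ m <= e / 3.
  rewrite mulrC -ler_pdivlMr// (le_trans _ (ltW (MP m (leq_maxr n M))))//.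
  rewrite lef_pV2 ?posrE ?exprn_gt0// -natrX ler_nat; exact: ltn_expl.
have /is_derive1P/(_ _ e30)[d d0 dP] := is_derive_derive1n (s m) k x.
exists (Num.min d 1) => [|h h0]; first by rewrite lt_min d0 ltr01.
rewrite lt_min => /andP[hd h1].
have xn' : `|x| <= n%:R by rewrite (le_trans _ xn)// lerDl.
have hn : `|h + x| <= n%:R.
  by rewrite addrC (le_trans (ler_normD _ _))// (le_trans _ xn)// lerD2l ltW.
have := dP h h0 hd.
have [_] := U_cvg kn xn' nm.
have := U_lipschitz kn xn' hn nm; rewrite addrK.
move: (U k (h + x)) (U k x) (U k.+1 x) ((s m)^`(k) (h + x)) ((s m)^`(k) x)
  ((s m)^`(k.+1) x) => a b c a' b' c'.
move=> ab cc' hh.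
have : `|h^-1 * (a - a' - (b - b'))| <= e / 3.
  rewrite normrM normfV ler_pdivrMl ?normr_gt0// (le_trans ab)// mulrC.
  by rewrite ler_wpM2l.
have -> : h^-1 * (a - b) - c = h^-1 * (a - a' - (b - b')) + (h^-1 * (a' - b') -
  c') - (c - c') by ring.
move: (h^-1 * _) (h^-1 * _) hh => v w; have := le_trans cc' me; rewrite
  !ler_norml; lra.
Qed.

Let derive1n_U k : (U 0)^`(k) = U k.
Proof.
elim: k => // k IHk; rewrite derive1nS IHk; apply/funext => x.
by rewrite derive1E; have [] := is_derive_U k x.
Qed.

(** Bounding the diagonal [p i (u i)] suffices for convergence in every seminorm, because
    [p n <= p i] as soon as [n <= i]. *)
Lemma smooth_series : exists v : smoothFun R, forall n m, (n <= m)%N ->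
  p n (v - \sum_(i < m) u i) <= n.+1%:R * (2 / 2 ^+ m).
Proof.
have sU : smooth (U 0).
  by move=> k x; rewrite derive1n_U; have [] := is_derive_U k x.
exists (mkSmooth sU) => n m nm; apply: smooth_seminorm_le => k x kn xn.
rewrite derive1n_smoothB/= derive1n_U.
by have [] := U_cvg kn xn nm.
Qed.

End completeness.

(** * A simultaneously universal family *)

Section universal_family.
Variables (R : realType) (alpha : nat -> nat -> R) (mu : nat -> nat).
Hypothesis alpha_neq0 : forall n k, (k <= n)%N -> alpha n k != 0.
Hypothesis alpha_cvg : forall k, cvg (alpha n k @[n --> \oo]).
Hypothesis mu_increasing : increasing_seq mu.
Local Notation S := (weighted_taylor alpha).
Local Notation p := (@smooth_seminorm R).

(** This exponent is the geometric mean of [16 ^ (2e)] and [16 ^ (2e + 2)], the inverse distances to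
    1 of the nodes [e] and [e.+1] used below to separate the powers. *)
Definition lacunary (e : nat) : nat := 16 ^ (e.*2.+1).

Lemma ltn_lacunary e : (e < lacunary e)%N.
Proof.
rewrite (leq_trans _ (ltnW (ltn_expl _ _)))// ltnS -addnn leq_addr//.
Qed.

Lemma ltn_lacunary2 : {mono lacunary : e e' / (e < e')%N}.
Proof. by move=> e e'; rewrite /lacunary ltn_exp2l// ltnS ltn_double. Qed.

(* The 2-adic valuation takes every value infinitely often. *)
Definition target (i : nat) : nat * {poly rat} :=
  if unpickle (logn 2 i.+1) is Some t then t else (0%N, 0).

Lemma target_recurrent l q s : exists2 i, (s <= i)%N & target i = (l, q).
Proof.
set c := pickle (l, q).
have i0 : (0 < 2 ^ c * s.*2.+1)%N by rewrite muln_gt0 expn_gt0.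
(* With this [i], the number [i.+1] is [2 ^ c] times an odd number, so its valuation is the code
   [c]; the odd factor makes [i >= s]. *)
exists (2 ^ c * s.*2.+1).-1.
  rewrite -ltnS prednK// (@leq_trans s.*2.+1)//; last by rewrite leq_pmull//
    expn_gt0.
  by rewrite ltnS -addnn leq_addr.
rewrite /target prednK// lognM ?expn_gt0// pfactorK// logn_coprime.
  by rewrite addn0 pickleK.
by rewrite coprime2n/= odd_double.
Qed.

(** The shift by 10 keeps the sum of the bounds on the [g l] below [1 / 256], which [coef1_le]
    absorbs, and lets the error beat the number of functions in [stage_error_le]. *)
Definition stage_error (i : nat) : R := (2 ^+ (i + 10))^-1.

Definition stage_target (i l : nat) : R -> R :=
  if l == (target i).1 then @rat_target R (target i).2 else fun=> 0.

Lemma stage_error_gt0 i : 0 < stage_error i.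
Proof. by rewrite invr_gt0 exprn_gt0. Qed.

Definition stage_update i e (F b : nat -> smoothFun R) (l : nat) :=
  F l + (if l == i then smooth_poly 'X^(lacunary e) else 0) + b l.

(** All functions introduced so far are steered at one common index, which exists since
    [approximation_step] accepts every large one. Whatever is added has order at least
    [lacunary e > mu j] at 0, hence leaves the partial sums up to [mu j] untouched. *)
Lemma stage_step i j (F : nat -> smoothFun R) :
  exists j' e (b : nat -> smoothFun R),
    [/\ (mu j < lacunary e)%N, (j < j')%N /\ (lacunary e <= mu j')%N,
        forall l, (i < l)%N -> b l = 0,
        forall l, (forall k, (k <= lacunary e)%N -> (b l)^`(k) 0 = 0) /\
          p (lacunary e) (b l) <= stage_error i &
        forall l x, (l <= i)%N -> `|x| <= i%:R ->
          `|S (mu j') (stage_update i e F b l) x - stage_target i l x|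
            <= stage_error i].
Proof.
pose e := mu j; pose K := lacunary e.
pose G l := F l + (if l == i then smooth_poly 'X^K else 0).
have /choice[m0 m0P] : forall l, exists m0, forall m, (m0 <= m)%N ->
    exists b : smoothFun R, [/\ forall k, (k <= K)%N -> b^`(k) 0 = 0,
      p K b < stage_error i & forall x, `|x| <= i%:R ->
        `|S m (G l + b) x - stage_target i l x| <= stage_error i].
  move=> l; apply: approximation_step => //; last exact: stage_error_gt0.
    by rewrite /stage_target; case: ifP => _ x;
      [exact: rat_target_continuous|exact: cvg_cst].
  by rewrite /stage_target; case: ifP => // _; exact: rat_target0.
pose j' := maxn j.+1 (maxn K (\max_(l < i.+1) m0 l)).
have j'mu : (j' <= mu j')%N by exact: increasing_seq_ge.
have /choice[b bP] : forall l, exists b : smoothFun R, ((l <= i)%N ->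
    [/\ forall k, (k <= K)%N -> b^`(k) 0 = 0,
      p K b < stage_error i & forall x, `|x| <= i%:R ->
        `|S (mu j') (G l + b) x - stage_target i l x| <= stage_error i]).
  move=> l; have [li|il] := leqP l i; last by exists 0.
  have li1 : (l < i.+1)%N by [].
  have [|b bP] := m0P l (mu j'); last by exists b.
  rewrite (leq_trans _ j'mu)// !leq_max.
  by rewrite (@leq_bigmax _ (fun l : 'I_i.+1 => m0 l) (Ordinal li1)) !orbT.
exists j', e, (fun l => if (l <= i)%N then b l else 0); split.
- exact: ltn_lacunary.
- by rewrite leq_maxl (leq_trans _ j'mu)// !leq_max leqnn !orbT.
- by move=> l il; rewrite leqNgt il.
- move=> l; case: leqP => [/bP[b0 /ltW be _]|_]; first by [].
  by split=> [k _|]; rewrite ?derive1n_smooth0// smooth_seminorm0 ltW//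
    stage_error_gt0.
- by move=> l x li xi; rewrite /stage_update li; have [_ _] := bP l li; apply.
Qed.

(** Limit passage in the form used below, where estimates come with a geometric remainder. *)
Lemma le0_geometric (a c : R) M :
  (forall m, (M <= m)%N -> a <= c / 2 ^+ m) -> a <= 0.
Proof.
move=> ac; rewrite leNgt; apply/negP => a0.
have [|N NP] := @invSn_lt R (a / (`|c| + 1)).
  by rewrite divr_gt0// ltr_wpDl.
pose m := maxn M N; have := ac m (leq_maxl _ _); apply/negP; rewrite -ltNge.
have : (2 ^+ m)^-1 < a / (`|c| + 1).
  rewrite (le_lt_trans _ (NP m (leq_maxr _ _)))//.
  by rewrite lef_pV2 ?posrE ?exprn_gt0// -natrX ler_nat ltn_expl.
rewrite ltr_pdivlMr ?ltr_wpDl// => lt; apply: le_lt_trans lt.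
rewrite [leRHS]mulrC ler_wpM2r ?invr_ge0 ?exprn_ge0//.
by rewrite (le_trans (ler_norm c))// lerDl.
Qed.

(** [g l] is the sum of the corrections of all stages. Those made after stage [i] have vanishing
    derivatives at 0 up to order [mu (J i)], so the estimates obtained at stage [i] survive in the
    limit; they are also small enough for the series to converge. *)
Lemma universal_family : exists (e J : nat -> nat) (g : nat -> smoothFun R),
  let f l := smooth_poly 'X^(lacunary (e l)) + g l in
  [/\ forall i, (e i < e i.+1)%N,
      forall i, (i <= J i)%N,
      forall l k, (k <= lacunary (e l))%N -> (g l)^`(k) 0 = 0,
      forall l n, (n <= l.+1)%N -> p n (g l) <= 2 * stage_error l &
      forall i l,
        ((i < l)%N -> forall k, (k <= mu (J i))%N -> (f l)^`(k) 0 = 0) /\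
        ((l <= i)%N -> forall x, `|x| <= i%:R ->
          `|S (mu (J i)) (f l) x - stage_target i l x| <= stage_error i)].
Proof.
(* A state consists of the stage number, the last index used and the current functions; an output
   consists of the next index, the parameter of the new exponent and the corrections. *)
have /choice[nxt nxtP] : forall s : nat * (nat * (nat -> smoothFun R)),
    exists o : nat * nat * (nat -> smoothFun R),
    [/\ (mu s.2.1 < lacunary o.1.2)%N,
        (s.2.1 < o.1.1)%N /\ (lacunary o.1.2 <= mu o.1.1)%N,
        forall l, (s.1 < l)%N -> o.2 l = 0,
        forall l, (forall k, (k <= lacunary o.1.2)%N -> (o.2 l)^`(k) 0 = 0) /\
          p (lacunary o.1.2) (o.2 l) <= stage_error s.1 &
        forall l x, (l <= s.1)%N -> `|x| <= s.1%:R ->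
          `|S (mu o.1.1) (stage_update s.1 o.1.2 s.2.2 o.2 l) x -
            stage_target s.1 l x| <= stage_error s.1].
  move=> [i [j F]]; have [j' [e [b ?]]] := stage_step i j F.
  by exists (j', e, b).
pose st := fix st i := if i is i'.+1 then
    let o := nxt (i', st i') in (o.1.1, stage_update i' o.1.2 (st i').2 o.2)
  else (0%N, (fun=> 0) : nat -> smoothFun R).
pose j i := (st i).1; pose F i := (st i).2.
pose e i := (nxt (i, st i)).1.2; pose b i := (nxt (i, st i)).2.
pose K i := lacunary (e i).
have muK i : (mu (j i) < K i)%N by have [] := nxtP (i, st i).
have jS i : (j i < j i.+1)%N by have [_ []] := nxtP (i, st i).
have Kmu i : (K i <= mu (j i.+1))%N by have [_ []] := nxtP (i, st i).
have b0 i l : (i < l)%N -> b i l = 0.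
  by have [_ _ + _ _] := nxtP (i, st i); apply.
have bT i l k : (k <= K i)%N -> (b i l)^`(k) 0 = 0.
  by have [_ _ _ /(_ l)[+ _] _] := nxtP (i, st i); apply.
have bp i l : p (K i) (b i l) <= stage_error i.
  by have [_ _ _ /(_ l)[_ +] _] := nxtP (i, st i).
have FS i l : F i.+1 l = stage_update i (e i) (F i) (b i) l by [].
have SF i l x : (l <= i)%N -> `|x| <= i%:R ->
    `|S (mu (j i.+1)) (F i.+1 l) x - stage_target i l x| <= stage_error i.
  by have [_ _ _ _ +] := nxtP (i, st i); apply.
have ij i : (i <= j i)%N by elim: i => // i IH; exact: leq_ltn_trans (jS i).
have iK i : (i < K i)%N.
  rewrite (leq_trans _ (muK i))// ltnS (leq_trans (ij i))//.
  exact: increasing_seq_ge.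
have KS i : (K i < K i.+1)%N by exact: leq_ltn_trans (Kmu i) (muK _).
have eS i : (e i < e i.+1)%N by rewrite -ltn_lacunary2; exact: KS.
have Kmono : {homo K : i i' / (i <= i')%N}.
  by apply: (homo_leq leqnn leq_trans) => i; exact: ltnW.
have FE i l : F i l =
    (if (l < i)%N then smooth_poly 'X^(K l) else 0) + \sum_(i' < i) b i' l.
  elim: i => [|i IHi]; first by rewrite big_ord0 addr0.
  rewrite FS /stage_update IHi big_ord_recr/= addrA; congr (_ + _).
  rewrite addrAC; congr (_ + _); rewrite ltnS.
  by case: (ltngtP l i) => [li|il|->]; rewrite ?addr0 ?add0r.
have bi l i : p i (b i l) <= (2 ^+ i)^-1.
  rewrite (le_trans (le_smooth_seminorm _ (ltnW (iK i))))//.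
  rewrite (le_trans (bp i l))// lef_pV2 ?posrE ?exprn_gt0//.
  by rewrite ler_weXn2l ?ler1n// leq_addr.
have /choice[g gP] : forall l, exists v : smoothFun R, forall n m, (n <= m)%N ->
    p n (v - \sum_(i < m) b i l) <= n.+1%:R * (2 / 2 ^+ m).
  by move=> l; exact: (@smooth_series R (fun i => b i l) (bi l)).
(* From stage [m] on, the corrections are flat up to order [K m], so only finitely many of them
   contribute to this derivative. *)
have gT l k m : (k <= K m)%N -> (g l)^`(k) 0 = \sum_(i < m) (b i l)^`(k) 0.
  move=> km; apply/eqP; rewrite -subr_eq0 -normr_le0.
  apply: (@le0_geometric _ (k.+1%:R * 2) (maxn k m)) => m'.
  rewrite geq_max => /andP[km' mm'].
  have -> : \sum_(i < m) (b i l)^`(k) 0 = (\sum_(i < m') b i l : smoothFun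
    R)^`(k) 0.
    rewrite derive1n_smooth_sum -(big_mkord xpredT (fun i => (b i l)^`(k) 0)).
    rewrite -(big_mkord xpredT (fun i => (b i l)^`(k) 0)).
    rewrite [RHS](big_cat_nat (leq0n m) mm')//=.
    rewrite [X in _ = _ + X](_ : _ = 0) ?addr0// big_nat big1// => i /andP[mi
      _].
    by rewrite bT// (leq_trans km)// Kmono.
  rewrite -derive1n_smoothB -mulrA (le_trans _ (gP l k m' km'))//.
  by rewrite ler_smooth_seminorm ?normr0.
(* The corrections of [g l] start at stage [l], and [l.+1 <= K i] for every [i >= l], so each is at
   most [stage_error i] in [p n]; the bounds telescope. *)
have gp l n : (n <= l.+1)%N -> p n (g l) <= 2 * stage_error l.
  move=> nl; rewrite -subr_le0.
  apply: (@le0_geometric _ (n.+1%:R * 2) (maxn n l)) => m.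
  rewrite geq_max => /andP[nm lm].
  have sb : \sum_(i < m) p n (b i l) <= 2 * stage_error l - 2 * stage_error m.
    elim: m lm {nm} => [|m IHm].
      by rewrite leqn0 => /eqP ->; rewrite big_ord0 subrr.
    rewrite leq_eqVlt => /predU1P[<-|lm].
      by rewrite subrr big1// => i _; rewrite b0// smooth_seminorm0.
    rewrite big_ord_recr/=.
    have pm : p n (b m l) <= stage_error m.
      rewrite (le_trans _ (bp m l))// le_smooth_seminorm//.
      by rewrite (leq_trans nl)// (leq_trans _ (iK m)).
    have := IHm lm.
    move: pm; have -> : stage_error m = 2 * stage_error m.+1.
      by rewrite /stage_error addSn exprS invfM mulrA mulfV// mul1r.
    lra.
  have := gP l n m nm; rewrite mulrA.
  have := smooth_seminorm_sum n (index_enum 'I_m) xpredT (fun i : 'I_m => b i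
    l).
  have := ler_smooth_seminormD n (g l - \sum_(i < m) b i l) (\sum_(i < m) b i
    l).
  have := stage_error_gt0 m; rewrite subrK; lra.
have fT i l k : (k <= mu (j i))%N ->
    (smooth_poly 'X^(K l) + g l)^`(k) 0 = (F i l)^`(k) 0.
  move=> ki; have kK : (k < K i)%N by exact: leq_ltn_trans (muK i).
  rewrite FE !derive1n_smoothD (gT l k i (ltnW kK)) derive1n_smooth_sum.
  case: ltnP => // il; rewrite derive1n_smooth_poly0 coefXn derive1n_smooth0.
  by rewrite ltn_eqF ?mul0r// (leq_trans kK)// Kmono.
(* The index reached at the end of stage [i] is the one at which its targets are met, hence the
   shift. *)
exists e, (fun i => j i.+1), g; split=> //.
- by move=> i; exact: leq_trans (ij i.+1).
- move=> l k kl; rewrite (gT l k l kl) big1// => i _; rewrite b0//.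
  exact: derive1n_smooth0.
move=> i l; split=> [il k ki|li x xi].
  rewrite (fT i.+1)// FE ltnNge il/= add0r derive1n_smooth_sum big1// => i' _.
  by rewrite b0 ?derive1n_smooth0// (leq_trans (ltn_ord i')).
rewrite (@eq_weighted_taylor _ _ _ _ (F i.+1 l)) ?SF// => k ki.
exact: fT.
Qed.

End universal_family.

(** * Lacunary sums and their perturbations *)

Section lacunary_sums.
Variable R : realType.
Local Notation p := (@smooth_seminorm R).

(* Between [node E] and [node E.+1], the power [lacunary E] grows from about 0
   to about 1, while lower powers stay close to 1 and higher ones close to 0. *)
Definition node (e : nat) : R := 1 - (16 ^+ e.*2)^-1.

Lemma node_bounds e : 0 <= node e <= 1.
Proof.
have E1 : 1 <= 16 ^+ e.*2 :> R by apply: exprn_ege1; rewrite ler1n.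
rewrite /node subr_ge0 gerBl invr_ge0 exprn_ge0// andbT.
by rewrite invf_le1 ?exprn_gt0.
Qed.

Lemma expr_onem_le (a : R) n : 0 <= a <= 1 -> (1 - a) ^+ n * (1 + n%:R * a) <=
  1.
Proof.
move=> /andP[a0 a1]; elim: n => [|n IHn]; first by rewrite expr0 mul0r addr0
  mulr1.
apply: le_trans IHn; rewrite exprSr -mulrA ler_wpM2l ?exprn_ge0 ?subr_ge0//.
have -> : n.+1%:R = n%:R + 1 :> R by rewrite natr1.
have : 0 <= n%:R :> R by []; nra.
Qed.

Lemma lacunaryE e : (lacunary e)%:R = 16 ^+ e.*2.+1 :> R.
Proof. by rewrite natrX. Qed.

(** By Bernoulli's inequality the defect from 1 is at most [16 ^ (2e + 1 - 2E)], and
    [2E - 2e - 1 >= E - e] because [e < E]. *)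
Lemma node_expr_ge e E : (e < E)%N ->
  1 - (16 ^+ (E - e))^-1 <= node E ^+ lacunary e.
Proof.
move=> eE; rewrite lerBlDr -lerBlDl (le_trans (onem_expr_le _ (node_bounds
  E)))//.
rewrite lacunaryE /node opprB addrCA subrr addr0.
rewrite ler_pdivrMr ?exprn_gt0// ler_pdivlMl ?exprn_gt0// -exprD ler_eXn2l
  ?ltr1n//.
by rewrite -!addnn; lia.
Qed.

Lemma node_expr_le e E : (E <= e)%N ->
  node E ^+ lacunary e <= (16 ^+ (e - E).+1)^-1.
Proof.
move=> Ee; set a := (16 ^+ E.*2)^-1 : R.
have a0 : 0 <= a by rewrite invr_ge0 exprn_ge0.
have A0 : 0 < 1 + (lacunary e)%:R * a by rewrite ltr_wpDr// mulr_ge0.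
rewrite -[leLHS](mulfK (lt0r_neq0 A0)) ler_pdivrMr//.
rewrite (le_trans (expr_onem_le _ _))//.
  by have := node_bounds E; rewrite /node -/a a0; lra.
rewrite ler_pdivlMl ?exprn_gt0// mulr1 (@le_trans _ _ ((lacunary e)%:R * a))//;
  last by rewrite lerDr.
rewrite lacunaryE ler_pdivlMr ?exprn_gt0// -exprD ler_eXn2l ?ltr1n//.
by rewrite -!addnn; lia.
Qed.

Definition node_diff E k : R := node E.+1 ^+ k - node E ^+ k.

Lemma node_diff_diag E : 7 / 8 <= node_diff E (lacunary E).
Proof.
have := node_expr_ge (ltnSn E); have := node_expr_le (leqnn E).
rewrite subSnn subnn expr1 /node_diff; lra.
Qed.

Lemma node_diff_lt E e : (e < E)%N ->
  `|node_diff E (lacunary e)| <= (16 ^+ (E - e))^-1.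
Proof.
move=> eE; have := node_expr_ge eE; have := node_expr_ge (ltnW eE : (e <
  E.+1)%N).
have node1 F : node F ^+ lacunary e <= 1.
  by have /andP[n0 n1] := node_bounds F; exact: exprn_ile1.
have := node1 E; have := node1 E.+1.
have : (16 ^+ (E.+1 - e))^-1 <= (16 ^+ (E - e))^-1 :> R.
  by rewrite lef_pV2 ?posrE ?exprn_gt0// ler_eXn2l ?ltr1n// leq_sub2r.
rewrite ler_norml /node_diff; lra.
Qed.

Lemma node_diff_gt E e : (E < e)%N ->
  `|node_diff E (lacunary e)| <= (16 ^+ (e - E))^-1.
Proof.
move=> Ee; have := node_expr_le Ee; have := node_expr_le (ltnW Ee).
rewrite subnSK//.
have node0 F : 0 <= node F ^+ lacunary e.
  by have /andP[n0 _] := node_bounds F; exact: exprn_ge0.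
have := node0 E; have := node0 E.+1.
have : (16 ^+ (e - E).+1)^-1 <= (16 ^+ (e - E))^-1 :> R.
  by rewrite lef_pV2 ?posrE ?exprn_gt0// ler_eXn2l ?ltr1n.
rewrite ler_norml /node_diff; lra.
Qed.

(** Diagonal dominance: the terms on each side of [L] are bounded by a geometric series of ratio
    [1 / 16], with sum at most [1 / 15], whence [2 / 15] in all. *)
Lemma dominant_term (d D : nat -> R) n L M : (L < n)%N ->
  (forall l, (l < n)%N -> `|d l| <= M) ->
  (forall l, (l < L)%N -> `|D l| <= (16 ^+ (L - l))^-1) ->
  (forall l, (L < l)%N -> `|D l| <= (16 ^+ (l - L))^-1) ->
  7 / 8 <= D L ->
  7 / 8 * `|d L| - 2 / 15 * M <= `|\sum_(l < n) d l * D l|.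
Proof.
move=> Ln dM Dlt Dgt DL.
have M0 : 0 <= M by rewrite (le_trans _ (dM L Ln)).
have low : `|\sum_(0 <= l < L) d l * D l| <= M * (1 / 15).
  have geo m : \sum_(0 <= l < m) (16 ^+ (m - l))^-1 <= 1 / 15 :> R.
    elim: m => [|m IHm]; first by rewrite big_nil divr_ge0.
    rewrite big_nat_recr//= subSnn expr1.
    have -> : \sum_(0 <= l < m) (16 ^+ (m.+1 - l))^-1 =
      16^-1 * \sum_(0 <= l < m) (16 ^+ (m - l))^-1 :> R.
      rewrite mulr_sumr; apply: eq_big_nat => l /andP[_ lm].
      by rewrite subSn 1?ltnW// exprS invfM.
    lra.
  rewrite (le_trans (ler_norm_sum _ _ _))// (le_trans _ (ler_wpM2l M0 (geo
    L)))//.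
  rewrite mulr_sumr; apply: ler_sum_nat => l /andP[_ lL].
  by rewrite normrM ler_pM ?Dlt// dM// (ltn_trans lL).
have high : `|\sum_(L.+1 <= l < n) d l * D l| <= M * (1 / 15).
  have geo r : \sum_(L.+1 <= l < L.+1 + r) (16 ^+ (l - L))^-1 <=
      1 / 15 - 1 / 15 / 16 ^+ r :> R.
    elim: r => [|r IHr]; first by rewrite addn0 big_geq// expr0; lra.
    rewrite addnS big_nat_recr ?leq_addr//= addSn subSn ?leq_addr// addKn.
    move: IHr; rewrite exprS invfM; move: ((16 ^+ _)^-1) => t; rewrite addSn;
      lra.
  rewrite (le_trans (ler_norm_sum _ _ _))//.
  rewrite (@le_trans _ _ (M * \sum_(L.+1 <= l < n) (16 ^+ (l - L))^-1))//.
    rewrite mulr_sumr; apply: ler_sum_nat => l /andP[Ll ln].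
    by rewrite normrM ler_pM ?Dgt// dM.
  by rewrite ler_wpM2l// -(subnKC Ln) (le_trans (geo _))// gerBl divr_ge0
    ?exprn_ge0.
rewrite -(big_mkord xpredT (fun l => d l * D l)).
rewrite (big_cat_nat (leq0n L) (ltnW Ln))/= (big_ltn Ln)/= addrCA.
have : 7 / 8 * `|d L| <= `|d L * D L|.
  by rewrite normrM mulrC ler_wpM2l// (le_trans DL)// ler_norm.
move: low high; set a := \sum_(0 <= l < L) _; set b := \sum_(L.+1 <= l < n) _.
have := lerB_normD (d L * D L) (a + b); have := ler_normD a b; lra.
Qed.

Lemma argmax_nat (d : nat -> R) n : (0 < n)%N ->
  exists2 L, (L < n)%N & forall l, (l < n)%N -> d l <= d L.
Proof.
case: n => // n _; have [L _ LP] := @arg_maxP _ _ 'I_n.+1 ord0 xpredT d isT.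
by exists L => // l ln; exact: (LP (Ordinal ln)).
Qed.

Variables (e : nat -> nat).
Hypothesis e_incr : forall i, (e i < e i.+1)%N.

Lemma e_sub i j : (i <= j)%N -> (j - i <= e j - e i)%N.
Proof.
have e_homo : {homo e : i j / (i <= j)%N}.
  by apply: (homo_leq leqnn leq_trans) => k; exact: ltnW.
elim: j => [|j IHj]; first by rewrite leqn0 => /eqP ->.
rewrite leq_eqVlt => /predU1P[->|ij]; first by rewrite subnn.
have := IHj ij; have := e_incr j; have := e_homo i j ij; move: ij; lia.
Qed.

(** For the index [L] maximising [|c l| * r^(lacunary (e l))], the values of the sum at two
    consecutive nodes scaled by [r] differ by at least [7/8 - 2/15] times this maximum, which
    exceeds half of it, and by at most twice the seminorm; hence the constant 4. *)
Lemma lacunary_coef_le (c : nat -> R) n r l : (l < n)%N ->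
  `|c l| * r%:R ^+ lacunary (e l) <=
    4 * p r (\sum_(l < n) c l *: smooth_poly 'X^(lacunary (e l))).
Proof.
move=> ln; set F := \sum_(_ < _) _.
pose d l := c l * r%:R ^+ lacunary (e l).
have [|L Ln Lmax] := @argmax_nat (fun l => `|d l|) n; first exact:
  leq_ltn_trans ln.
have FE t : F (r%:R * t) = \sum_(l < n) d l * t ^+ lacunary (e l).
  have := derive1n_smooth_sum 0 (index_enum 'I_n) xpredT
    (fun l : 'I_n => c l *: smooth_poly 'X^(lacunary (e l))) (r%:R * t).
  rewrite -/F /= => ->; apply: eq_bigr => i _.
  have := derive1n_smoothZ 0 (c i) (smooth_poly 'X^(lacunary (e i))) (r%:R * t).
  by rewrite /= hornerXn exprMn mulrA.
have Fle E : `|F (r%:R * node E)| <= p r F.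
  apply: (@ler_smooth_seminorm R r F 0%N) => //.
  have /andP[n0 n1] := node_bounds E.
  by rewrite ger0_norm ?mulr_ge0// ler_piMr.
have := @dominant_term d (fun l => node_diff (e L) (lacunary (e l))) n L `|d L|
  Ln Lmax.
have -> : \sum_(l < n) d l * node_diff (e L) (lacunary (e l)) =
  F (r%:R * node (e L).+1) - F (r%:R * node (e L)).
  by rewrite !FE -sumrB; apply: eq_bigr => i _; rewrite mulrBr.
have ee : {mono e : i j / (i < j)%N} by apply: leqW_mono; apply: leq_mono;
  apply: homo_ltn => //; exact: ltn_trans.
have le16 i j : (i <= j)%N -> (16 ^+ (e j - e i))^-1 <= (16 ^+ (j - i))^-1 :> R.
  by move=> ij; rewrite lef_pV2 ?posrE ?exprn_gt0// ler_eXn2l ?ltr1n// e_sub.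
have := Lmax l ln; rewrite normrM normrX (ger0_norm (ler0n _ _)).
move=> /le_trans + dom; apply.
have : 7 / 8 * `|d L| - 2 / 15 * `|d L| <= `|F (r%:R * node (e L).+1) - F (r%:R
  * node (e L))|.
  apply: dom => [i iL|i Li|].
  - by rewrite (le_trans (node_diff_lt _)) ?ee ?le16// ltnW.
  - by rewrite (le_trans (node_diff_gt _)) ?ee ?le16// ltnW.
  - exact: node_diff_diag.
have := ler_normB (F (r%:R * node (e L).+1)) (F (r%:R * node (e L))).
have := Fle (e L); have := Fle (e L).+1; have := normr_ge0 (d L); lra.
Qed.

End lacunary_sums.

(** * Closures, Lipschitz functionals and finite spans *)

Section closed_span.
Variable R : realType.
Implicit Types (A : smoothFun R -> R) (E : set (smoothFun R)).
Local Notation p := (@smooth_seminorm R).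

Lemma closure_smoothP E f : closure E f <->
  forall n e, 0 < e -> exists2 F, E F & p n (f - F) < e.
Proof.
split=> [cf n e e0|Ef B /nbhs_smoothP[n [e [e0 eB]]]].
  have [F [EF /= fF]] : E `&` [set g | p n (f - g) < e] !=set0.
    by apply: cf; apply/nbhs_smoothP; exists n, e; split.
  by exists F.
by have [F EF fF] := Ef n e e0; exists F; split=> //; exact: eB.
Qed.

(** This form of continuity covers absolute values and the seminorms themselves besides linear
    functionals, so that whole inequalities pass from a span to its closure. *)
Definition seminorm_lipschitz A := exists n C, 0 <= C /\
  forall f f', `|A f - A f'| <= C * p n (f - f').

Lemma seminorm_lipschitzD A B : seminorm_lipschitz A -> seminorm_lipschitz B ->
  seminorm_lipschitz (fun f => A f + B f).
Proof.
move=> [n [C [C0 AP]]] [m [D [D0 BP]]]; exists (maxn n m), (C + D).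
split=> [|f f']; first exact: addr_ge0.
have -> : A f + B f - (A f' + B f') = (A f - A f') + (B f - B f') by ring.
rewrite (le_trans (ler_normD _ _))// mulrDl lerD//.
  by rewrite (le_trans (AP _ _))// ler_wpM2l// le_smooth_seminorm ?leq_maxl.
by rewrite (le_trans (BP _ _))// ler_wpM2l// le_smooth_seminorm ?leq_maxr.
Qed.

Lemma seminorm_lipschitzZ a A : seminorm_lipschitz A ->
  seminorm_lipschitz (fun f => a * A f).
Proof.
move=> [n [C [C0 AP]]]; exists n, (`|a| * C); split=> [|f f'].
  exact: mulr_ge0.
by rewrite -mulrBr normrM -mulrA ler_wpM2l.
Qed.

Lemma seminorm_lipschitz_norm A : seminorm_lipschitz A ->
  seminorm_lipschitz (fun f => `|A f|).
Proof.
move=> [n [C [C0 AP]]]; exists n, C; split=> // f f'.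
by rewrite (le_trans (ler_dist_dist _ _)).
Qed.

Lemma seminorm_lipschitz_sum n (A : nat -> smoothFun R -> R) :
  (forall i, seminorm_lipschitz (A i)) ->
  seminorm_lipschitz (fun f => \sum_(i < n) A i f).
Proof.
move=> AP; elim: n => [|n IHn].
  exists 0%N, 0; split=> // f f'.
  by rewrite !big_ord0 subrr normr0 mul0r.
have -> : (fun f => \sum_(i < n.+1) A i f) =
    (fun f => \sum_(i < n) A i f + A n f).
  by apply/funext => f; rewrite big_ord_recr.
exact: seminorm_lipschitzD.
Qed.

Lemma seminorm_lipschitz_seminorm n : seminorm_lipschitz (p n).
Proof.
exists n, 1; split=> // f f'; rewrite mul1r ler_norml; apply/andP; split.
  rewrite lerNl opprB lerBlDr smooth_seminormBC -{1}(subrK f f').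
  exact: ler_smooth_seminormD.
by rewrite lerBlDr -{1}(subrK f' f) ler_smooth_seminormD.
Qed.

Lemma seminorm_lipschitz_derive1n k : seminorm_lipschitz (fun f => f^`(k) 0).
Proof.
exists k, 1; split=> // f f'.
by rewrite mul1r -derive1n_smoothB ler_smooth_seminorm ?normr0.
Qed.

Lemma closure_le0 E A : seminorm_lipschitz A -> (forall F, E F -> A F <= 0) ->
  forall f, closure E f -> A f <= 0.
Proof.
move=> [n [C [C0 AP]]] E0 f /closure_smoothP Ef.
rewrite leNgt; apply/negP => Af.
have C1 : 0 < C + 1 by rewrite ltr_wpDl.
have [|F EF fF] := Ef n (A f / (C + 1)); first by rewrite divr_gt0.
have := E0 F EF; apply/negP; rewrite -ltNge.
have : C * p n (f - F) < A f.
  rewrite (@le_lt_trans _ _ ((C + 1) * p n (f - F)))//.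
    by rewrite ler_wpM2r ?smooth_seminorm_ge0// lerDl.
  by rewrite mulrC -ltr_pdivlMr.
have := AP f F; rewrite ler_norml; lra.
Qed.

Lemma linear_subspace_closure E : linear_subspace E -> linear_subspace (closure
  E).
Proof.
move=> [E0 EZ]; split=> [|a f f' /set_mem /closure_smoothP Ef /set_mem
  /closure_smoothP Ef'].
  by apply/mem_set; apply: subset_closure; exact: set_mem E0.
apply/mem_set/closure_smoothP => n e e0.
have e20 : 0 < e / 2 by rewrite divr_gt0.
have a1 : 0 < `|a| + 1 by rewrite ltr_wpDl.
have [|F EF fF] := Ef n (e / 2 / (`|a| + 1)); first by rewrite divr_gt0.
have [F' EF' fF'] := Ef' n _ e20.
exists (a *: F + F').
  by apply/set_mem; apply: EZ; exact: mem_set.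
have -> : a *: f + f' - (a *: F + F') = a *: (f - F) + (f' - F').
  by rewrite scalerBr opprD addrACA.
rewrite (le_lt_trans (ler_smooth_seminormD _ _ _))// smooth_seminormZ.
rewrite [ltRHS]splitr ler_ltD// (le_trans (ler_wpM2l _ (ltW fF)))//.
by apply: mulr_div1p_le => //; exact: ltW.
Qed.

Definition finite_span (v : nat -> smoothFun R) : set (smoothFun R) :=
  [set F | exists n (c : nat -> R), F = \sum_(l < n) c l *: v l].

Lemma linear_subspace_finite_span v : linear_subspace (finite_span v).
Proof.
split; first by apply/mem_set; exists 0%N, (fun=> 0); rewrite big_ord0.
move=> a _ _ /set_mem[n [c ->]] /set_mem[n' [c' ->]]; apply/mem_set.
have pad m (d : nat -> R) N : (m <= N)%N -> \sum_(l < m) d l *: v l =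
    \sum_(l < N) (if (l < m)%N then d l else 0) *: v l.
  move=> mN; rewrite (big_ord_widen N (fun l => d l *: v l) mN) big_mkcond/=.
  by apply: eq_bigr => l _; case: ifP => // _; rewrite scale0r.
exists (maxn n n'), (fun l => a * (if (l < n)%N then c l else 0) +
  (if (l < n')%N then c' l else 0)).
rewrite (pad n c _ (leq_maxl n n')) (pad n' c' _ (leq_maxr n n')).
rewrite scaler_sumr -big_split/=; apply: eq_bigr => l _.
by rewrite scalerDl scalerA.
Qed.

End closed_span.

Lemma ler_sum_restrict (R : numDomainType) (a : nat -> R) n r :
  (forall l, 0 <= a l) ->
  \sum_(l < n) (if (l < r)%N then a l else 0) <= \sum_(l < r) a l.
Proof.
move=> a0; rewrite -big_mkcond/=.
have [rn|/ltnW nr] := leqP r n; first by rewrite -(big_ord_widen n a rn).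
rewrite (eq_bigl xpredT) => [|l]; last by rewrite (leq_trans (ltn_ord l)).
rewrite -(big_mkord xpredT a) -[leRHS](big_mkord xpredT a).
by rewrite (big_cat_nat (leq0n n) nr)/= lerDl sumr_ge0.
Qed.

Lemma sum_geometric_tail (R : realFieldType) n r :
  \sum_(l < n) (if (r <= l)%N then (2 ^+ l)^-1 else 0) <= 2 / 2 ^+ r :> R.
Proof.
suff : \sum_(l < n) (if (r <= l)%N then (2 ^+ l)^-1 else 0) <=
    (if (r <= n)%N then 2 / 2 ^+ r - 2 / 2 ^+ n else 0) :> R.
  move=> /le_trans; apply; case: ifP => _; last by rewrite divr_ge0 ?exprn_ge0.
  by rewrite gerBl divr_ge0 ?exprn_ge0.
elim: n => [|n IHn].
  by rewrite big_ord0; case: ifP => //; rewrite leqn0 => /eqP ->; rewrite subrr.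
rewrite big_ord_recr/=; move: IHn; rewrite [(r <= n.+1)%N]leq_eqVlt ltnS.
case: (leqP r n) => [rn|nr]; last first.
  case: eqP => [->|_] h; first by rewrite subrr addr0.
  by rewrite addr0.
by rewrite orbT exprS invfM; move: ((2 ^+ n)^-1) => t; lra.
Qed.

Lemma bin_le_expn2 n m : ('C(n, m) <= 2 ^ n)%N.
Proof.
elim: n m => [|n IHn] [|m] //; first by rewrite bin0 expn_gt0.
by rewrite binS expnS mul2n -addnn leq_add.
Qed.

(** * Coefficient functionals of the perturbed lacunary family *)

Section perturbed_lacunary.
Variables (R : realType) (e : nat -> nat) (g : nat -> smoothFun R).
Local Notation p := (@smooth_seminorm R).
Local Notation K l := (lacunary (e l)).
Hypothesis e_incr : forall i, (e i < e i.+1)%N.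
Hypothesis g_flat : forall l k, (k <= K l)%N -> (g l)^`(k) 0 = 0.
Hypothesis g_small :
  forall l n, (n <= l.+1)%N -> p n (g l) <= 2 * stage_error R l.

Let f l := smooth_poly 'X^(K l) + g l.
Let F (c : nat -> R) n := \sum_(l < n) c l *: f l.

Let e_homo : {homo e : i j / (i < j)%N}.
Proof. by apply: homo_ltn => //; exact: ltn_trans. Qed.

Let e_ge i : (i <= e i)%N.
Proof. by elim: i => // i IHi; exact: leq_ltn_trans (e_incr i). Qed.

Let stage_errorS i : stage_error R i = 2 * stage_error R i.+1.
Proof. by rewrite /stage_error addSn exprS invfM mulrA mulfV// mul1r. Qed.

Let sum_stage_error n : \sum_(l < n) 2 * stage_error R l <= 1 / 256.
Proof.
have -> : 1 / 256 = 4 * stage_error R 0.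
  by rewrite /stage_error add0n; lra.
suff : \sum_(l < n) 2 * stage_error R l <=
    4 * stage_error R 0 - 4 * stage_error R n.
  by move/le_trans; apply; rewrite gerBl mulr_ge0// ltW// stage_error_gt0.
elim: n => [|n IHn]; first by rewrite big_ord0 subrr.
by rewrite big_ord_recr/=; have := stage_errorS n; lra.
Qed.

Let sum_g r : exists2 G, 0 <= G & forall n, \sum_(l < n) p r (g l) <= G.
Proof.
exists (\sum_(l < r) p r (g l) + 1) => [|n].
  by rewrite addr_ge0// sumr_ge0// => l _; exact: smooth_seminorm_ge0.
apply: (@le_trans _ _ (\sum_(l < n) ((if (l < r)%N then p r (g l) else 0) +
    2 * stage_error R l))).
  apply: ler_sum => l _; case: ltnP => [_|rl]; last by rewrite add0r g_small//
    ltnW.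
  by rewrite lerDl mulr_ge0// ltW// stage_error_gt0.
rewrite big_split/= lerD//; last by rewrite (le_trans (sum_stage_error n))//;
  lra.
by apply: (@ler_sum_restrict R (fun l => p r (g l))) => l; exact:
  smooth_seminorm_ge0.
Qed.

(** In the seminorm of index 1 the perturbations weigh at most [1 / 256] of the largest coefficient.
    This is absorbed into the left-hand side, at the price of replacing the constant 4 by 8. *)
Let coef1_le c n l : (l < n)%N -> `|c l| <= 8 * p 1 (F c n).
Proof.
move=> ln.
have [|L Ln Lmax] := @argmax_nat R (fun l => `|c l|) n; first exact:
  leq_ltn_trans ln.
rewrite (le_trans (Lmax l ln))//.
have := lacunary_coef_le e_incr c 1 Ln; rewrite expr1n mulr1.
set X := \sum_(_ < _) _.
have -> : X = F c n - \sum_(l < n) c l *: g l.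
  by rewrite -sumrB; apply: eq_bigr => i _; rewrite -scalerBr addrK.
have := ler_smooth_seminormD 1 (F c n) (- \sum_(l < n) c l *: g l).
rewrite smooth_seminormN.
have : p 1 (\sum_(l < n) c l *: g l) <= `|c L| * (1 / 256).
  rewrite (le_trans (smooth_seminorm_sum _ _ _ _))//.
  rewrite (le_trans _ (ler_wpM2l _ (sum_stage_error n)))// mulr_sumr.
  apply: ler_sum => i _; rewrite smooth_seminormZ ler_pM ?smooth_seminorm_ge0//.
    exact: Lmax.
  exact: g_small.
have := smooth_seminorm_ge0 1 (F c n); have := normr_ge0 (c L); lra.
Qed.

(** In a higher seminorm the perturbations may be large, but their seminorms have sums bounded by
    some [G] and the coefficients are at most [8 * p r], which gives the constant
    [4 * (1 + 8 * G)]. *)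
Lemma perturbed_coef_le r : (0 < r)%N -> exists2 C, 0 <= C &
  forall c n l, (l < n)%N -> `|c l| * r%:R ^+ K l <=
    C * p r (\sum_(l < n) c l *: (smooth_poly 'X^(K l) + g l)).
Proof.
move=> r0; have [G G0 GP] := sum_g r; exists (4 + 32 * G).
  by rewrite addr_ge0// mulr_ge0.
move=> c n l ln; rewrite -/(F c n).
rewrite (le_trans (lacunary_coef_le e_incr c r ln))//.
set X := \sum_(_ < _) _.
have -> : X = F c n - \sum_(l < n) c l *: g l.
  by rewrite -sumrB; apply: eq_bigr => i _; rewrite -scalerBr addrK.
have := ler_smooth_seminormD r (F c n) (- \sum_(l < n) c l *: g l).
rewrite smooth_seminormN.
have : p r (\sum_(l < n) c l *: g l) <= 8 * p r (F c n) * G.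
  rewrite (le_trans (smooth_seminorm_sum _ _ _ _))//.
  rewrite (le_trans _ (ler_wpM2l _ (GP n)))//; last first.
    by rewrite mulr_ge0// smooth_seminorm_ge0.
  rewrite mulr_sumr; apply: ler_sum => i _; rewrite smooth_seminormZ.
  rewrite ler_wpM2r ?smooth_seminorm_ge0// (le_trans (coef1_le c (ltn_ord
    i)))//.
  by rewrite ler_wpM2l// le_smooth_seminorm.
lra.
Qed.

(** Differentiating [j] times produces the falling factorial ['C(k, j) * j!], at most [2 ^ k * r!]:
    hence the factor 2 in the base. *)
Lemma smooth_monomial_le r k : (0 < r)%N ->
  p r (smooth_poly 'X^k) <= r.+1%:R * r`!%:R * (2 * r%:R) ^+ k.
Proof.
move=> r0; rewrite -mulrA; apply: smooth_seminorm_le => j x jr xr.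
rewrite derive1n_smooth_poly derivnXn hornerMn hornerXn.
rewrite -mulr_natr normrM normrX [`|_%:R|]ger0_norm// mulrC.
have r1 : 1 <= r%:R :> R by rewrite ler1n.
have [kj|jk] := ltnP k j; first by rewrite ffact_small// mul0r mulr_ge0
  ?exprn_ge0 ?mulr_ge0.
rewrite exprMn mulrA ler_pM ?exprn_ge0//.
  rewrite -natrX -natrM ler_nat -bin_ffact mulnC leq_mul ?bin_le_expn2//.
  exact: leq_fact.
rewrite (@le_trans _ _ (r%:R ^+ (k - j)))//.
  by rewrite lerXn2r ?nnegrE.
by rewrite ler_weXn2l// leq_subr.
Qed.

Let derive_f l j : (l <= j)%N ->
  (f j)^`(K l) 0 = if j == l then (K l)`!%:R else 0.
Proof.
rewrite leq_eqVlt => /predU1P[->|lj].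
  by rewrite derive1n_smoothD derive1n_smooth_poly0 coefXn g_flat// !eqxx mul1r
    addr0.
have KK : (K l < K j)%N by rewrite ltn_lacunary2 e_homo.
rewrite derive1n_smoothD derive1n_smooth_poly0 coefXn g_flat 1?ltnW// addr0.
by rewrite (gtn_eqF lj) (ltn_eqF KK) mul0r.
Qed.

(** The matrix of the derivatives of order [K l] at 0 of the functions [f j] is triangular with
    non-zero diagonal, so [G l] results from forward elimination: the derivative of order [K l],
    corrected by the earlier functionals. *)
Lemma biorthogonal l : exists G : smoothFun R -> R, [/\
  forall a u v, G (a *: u + v) = a * G u + G v, seminorm_lipschitz G &
  forall j, G (smooth_poly 'X^(K j) + g j) = (j == l)%:R].
Proof.
elim/ltn_ind: l => l IHl.
have /choice[G GP] : forall j, exists G : smoothFun R -> R, [/\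
    forall a u v, G (a *: u + v) = a * G u + G v, seminorm_lipschitz G &
    (j < l)%N -> forall j', G (f j') = (j' == j)%:R].
  move=> j; have [jl|_] := ltnP j l; last first.
    exists (fun=> 0); split=> // [a _ _|]; first by rewrite mulr0 addr0.
    by exists 0%N, 0; split=> // u v; rewrite subrr normr0 mul0r.
  by have [G [G1 G2 G3]] := IHl j jl; exists G.
have k0 : (K l)`!%:R != 0 :> R by rewrite pnatr_eq0 -lt0n fact_gt0.
have Glin j a u v : G j (a *: u + v) = a * G j u + G j v by have [] := GP j.
exists (fun u : smoothFun R => (K l)`!%:R^-1 *
  (u^`(K l) 0 + (-1) * \sum_(j < l) (f j)^`(K l) 0 * G j u)); split.
- move=> a u v; rewrite derive1n_smoothZD.
  under eq_bigr => j _ do rewrite Glin mulrDr mulrCA.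
  by rewrite big_split/= -mulr_sumr; ring.
- apply: seminorm_lipschitzZ; apply: seminorm_lipschitzD.
    exact: seminorm_lipschitz_derive1n.
  apply: seminorm_lipschitzZ; apply: (@seminorm_lipschitz_sum _ l
    (fun j (u : smoothFun R) => (f j)^`(K l) 0 * G j u)) => j.
  by apply: seminorm_lipschitzZ; have [] := GP j.
- move=> j; rewrite -/(f j).
  have [jl|lj] := ltnP j l.
    rewrite (bigD1 (Ordinal jl))//= big1 => [|i ij].
      have [_ _ ->//] := GP j; rewrite eqxx mulr1 addr0 mulN1r subrr mulr0.
      by rewrite (ltn_eqF jl).
    have [_ _ ->//] := GP i; rewrite eq_sym (_ : _ == _ = false) ?mulr0//.
    by apply/eqP => ij'; move: ij; rewrite -val_eqE/= ij' eqxx.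
  rewrite derive_f// big1 => [|i _].
    by rewrite mulr0 addr0; case: eqP => _; rewrite ?mulVf ?mulr0.
  have [_ _ ->//] := GP i.
  by rewrite gtn_eqF ?mulr0// (leq_trans (ltn_ord i)).
Qed.

Variable G : nat -> smoothFun R -> R.
Hypothesis G_linear : forall l a u v, G l (a *: u + v) = a * G l u + G l v.
Hypothesis G_lipschitz : forall l, seminorm_lipschitz (G l).
Hypothesis G_dual : forall l j, G l (smooth_poly 'X^(K j) + g j) = (j == l)%:R.

Let G_sum l (c : nat -> R) n :
  G l (\sum_(j < n) c j *: f j) = if (l < n)%N then c l else 0.
Proof.
elim: n => [|n IHn].
  have := G_linear l (-1) 0 0; rewrite big_ord0 scaler0 addr0.
  by rewrite mulN1r addNr.
rewrite big_ord_recr/= addrC G_linear IHn G_dual ltnS [(l <= n)%N]leq_eqVlt.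
by case: (ltngtP n l) => [_|_|->] /=; rewrite ?mulr0 ?mulr1 ?addr0 ?add0r.
Qed.

Lemma closed_span_coef_le r : (0 < r)%N -> exists2 C, 0 <= C &
  forall u, closure (finite_span f) u -> forall l,
    `|G l u| * r%:R ^+ K l <= C * p r u.
Proof.
move=> r0; have [C C0 CP] := perturbed_coef_le r0; exists C => // u Vu l.
rewrite -subr_le0.
apply: (closure_le0 (A := fun u : smoothFun R => `|G l u| * r%:R ^+ K l - C * p
  r u)
  _ _ Vu).
  rewrite (_ : (fun _ => _) = fun u : smoothFun R => r%:R ^+ K l * `|G l u| +
    (- C) * p r u).
    apply: seminorm_lipschitzD; apply: seminorm_lipschitzZ.
      exact: seminorm_lipschitz_norm.
    exact: seminorm_lipschitz_seminorm.
  by apply/funext => v; rewrite mulrC mulNr.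
move=> _ [n [c ->]]; rewrite subr_le0 G_sum; case: ifPn => [ln|_].
  exact: CP.
by rewrite normr0 mul0r mulr_ge0// smooth_seminorm_ge0.
Qed.

(** At an order to which only [f 0, ..., f i] contribute, both sides depend continuously on [u] and
    agree on finite combinations, hence on the closure. *)
Lemma closed_span_derive1n i k : (forall l, (i < l)%N -> (f l)^`(k) 0 = 0) ->
  forall u, closure (finite_span f) u ->
  u^`(k) 0 = \sum_(l < i.+1) G l u * (f l)^`(k) 0.
Proof.
move=> fk u Vu; apply/eqP; rewrite -subr_eq0 -normr_le0.
apply: (closure_le0 (A := fun u : smoothFun R =>
  `|u^`(k) 0 - \sum_(l < i.+1) G l u * (f l)^`(k) 0|) _ _ Vu).
  apply: seminorm_lipschitz_norm.
  rewrite (_ : (fun _ => _) = fun u : smoothFun R => u^`(k) 0 +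
    (-1) * \sum_(l < i.+1) (f l)^`(k) 0 * G l u); last first.
    apply/funext => v; rewrite mulN1r; congr (_ - _).
    by apply: eq_bigr => l _; rewrite mulrC.
  apply: seminorm_lipschitzD; first exact: seminorm_lipschitz_derive1n.
  apply: seminorm_lipschitzZ; apply: (@seminorm_lipschitz_sum _ i.+1
    (fun l (u : smoothFun R) => (f l)^`(k) 0 * G l u)) => l.
  by apply: seminorm_lipschitzZ; exact: G_lipschitz.
move=> _ [n [c ->]]; rewrite derive1n_smooth_sum.
under eq_bigr do rewrite derive1n_smoothZ.
under [X in _ - X]eq_bigr do rewrite G_sum.
pose a l := c l * (f l)^`(k) 0.
have pad m N : (m <= N)%N -> \sum_(l < m) a l =
    \sum_(l < N) (if (l < m)%N then a l else 0).
  by move=> mN; rewrite (big_ord_widen N a mN) big_mkcond.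
rewrite (pad n _ (leq_maxl n i.+1)).
rewrite [X in _ - X](_ : _ = \sum_(l < maxn n i.+1)
    (if (l < i.+1)%N then (if (l < n)%N then a l else 0) else 0)); last first.
  rewrite -big_mkcond/= -(big_ord_widen _ (fun l => if (l < n)%N then a l else
    0))
    ?leq_maxr//.
  by apply: eq_bigr => l _; case: ifP => // _; rewrite mul0r.
rewrite -sumrB big1 ?normr0// => l _; case: ifP => _; last by case: ifP;
  rewrite subrr.
by case: ltnP => [_|il]; rewrite ?subrr// subr0 /a fk// mulr0.
Qed.

(** Apart from the small [g l], the term of index [l] of a finite combination is in [p n] at most a
    constant times [|c l| * (2n)^(K l)], whereas [perturbed_coef_le] at radius [4n] controls
    [|c l| * (4n)^(K l)]. The ratio [2^(K l) >= 2^l] makes the tails geometric, so the coefficients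
    determine [u]. *)
Lemma closed_span_eq0 u : closure (finite_span f) u ->
  (forall l, G l u = 0) -> u = 0.
Proof.
move=> Vu Gu0; apply: smooth_seminorm_eq0 => n; apply/le_anti.
rewrite smooth_seminorm_ge0 andbT.
wlog n0 : n / (0 < n)%N.
  move=> wl; rewrite (le_trans (le_smooth_seminorm u (leqnSn n)))//; exact: wl.
have [C C0 CP] : exists2 C, 0 <= C & forall c m l, (l < m)%N ->
    `|c l| * (4 * n)%N%:R ^+ K l <= C * p (4 * n) (\sum_(l < m) c l *: f l).
  by apply: perturbed_coef_le; rewrite muln_gt0.
pose B := n.+1%:R * n`!%:R : R.
have B0 : 0 <= B by rewrite mulr_ge0.
pose D := (B + 1) * C * p (4 * n) u * 2.
apply: (@le0_geometric _ _ D n) => m nm.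
(* The vanishing coefficients are put back because the inequality is first proved for finite
   combinations, whose coefficients need not vanish. *)
have -> : D / 2 ^+ m = \sum_(l < m) p n (f l) * `|G l u| + (B + 1) * C * (2 / 2
  ^+ m) * p (4 * n) u.
  rewrite big1 => [|l _]; last by rewrite Gu0 normr0 mulr0.
  by rewrite /D; ring.
rewrite -subr_le0.
apply: (closure_le0 (A := fun u : smoothFun R => p n u - (\sum_(l < m) p n (f
  l) * `|G l u| +
  (B + 1) * C * (2 / 2 ^+ m) * p (4 * n) u)) _ _ Vu).
  rewrite (_ : (fun _ => _) = fun u : smoothFun R => p n u + (-1) *
     (\sum_(l < m) p n (f l) * `|G l u| +
     (B + 1) * C * (2 / 2 ^+ m) * p (4 * n) u)); last first.
    by apply/funext => v; rewrite mulN1r.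
  apply: seminorm_lipschitzD; first exact: seminorm_lipschitz_seminorm.
  apply: seminorm_lipschitzZ; apply: seminorm_lipschitzD; last first.
    by apply: seminorm_lipschitzZ; exact: seminorm_lipschitz_seminorm.
  apply: (@seminorm_lipschitz_sum _ m (fun l (u : smoothFun R) => p n (f l) *
    `|G l u|)) => l.
  by apply: seminorm_lipschitzZ; exact: seminorm_lipschitz_norm.
move=> _ [N [c ->]]; rewrite subr_le0.
set v := \sum_(l < N) c l *: f l.
have term l : (l < N)%N -> p n (c l *: f l) <=
    (if (l < m)%N then p n (f l) * `|G l v| else 0) +
    (B + 1) * C * p (4 * n) v * (if (m <= l)%N then (2 ^+ l)^-1 else 0).
  move=> lN; rewrite smooth_seminormZ G_sum lN; case: ltnP => [_|ml].
    by rewrite mulr0 addr0 mulrC.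
  rewrite add0r.
  have cC := CP c N l lN.
  have lK : (l <= K l)%N by rewrite (leq_trans (e_ge l))// ltnW// ltn_lacunary.
  have c4 : `|c l| * (4 * n)%N%:R ^+ K l = `|c l| * (2 * n%:R) ^+ K l * 2 ^+ K
    l.
    by rewrite -mulrA -exprMn natrM; congr (_ * _ ^+ _); ring.
  have cK : `|c l| * (2 * n%:R) ^+ K l <= C * p (4 * n) v * (2 ^+ l)^-1.
    rewrite ler_pdivlMr ?exprn_gt0// (le_trans _ cC)// c4.
    rewrite ler_wpM2l ?mulr_ge0 ?exprn_ge0 ?mulr_ge0//.
    by rewrite ler_weXn2l ?ler1n.
  have c1 : `|c l| <= C * p (4 * n) v.
    rewrite (le_trans _ cC)// ler_peMr// exprn_ege1// ler1n muln_gt0 n0//.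
  have fl : p n (f l) <= B * (2 * n%:R) ^+ K l + (2 ^+ l)^-1.
    rewrite (le_trans (ler_smooth_seminormD _ _ _))// lerD
      ?smooth_monomial_le//.
    rewrite (le_trans (g_small _)) ?(leq_trans nm) ?(leq_trans ml)//.
    rewrite /stage_error exprD invfM mulrCA ler_piMr ?invr_ge0 ?exprn_ge0//.
    lra.
  rewrite (le_trans (ler_wpM2l (normr_ge0 _) fl))//.
  have := ler_wpM2l B0 cK.
  have t0 : 0 <= (2 ^+ l)^-1 :> R by rewrite invr_ge0 exprn_ge0.
  have := ler_wpM2r t0 c1.
  move: ((2 ^+ l)^-1) (p (4 * n) v) ((2 * n%:R) ^+ K l) => t q w; lra.
rewrite (le_trans (smooth_seminorm_sum _ _ _ _))//.
rewrite (le_trans (ler_sum _ (fun (i : 'I_N) _ => term i (ltn_ord i))))//.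
rewrite big_split/= lerD//.
  apply: (@ler_sum_restrict R (fun l => p n (f l) * `|G l v|)) => l.
  by rewrite mulr_ge0// smooth_seminorm_ge0.
rewrite -mulr_sumr -[leRHS]mulrAC ler_wpM2l ?sum_geometric_tail//.
by rewrite !mulr_ge0 ?addr_ge0// smooth_seminorm_ge0.
Qed.

End perturbed_lacunary.

(** * Universal subspaces *)

Section rational_polynomials.
Variable R : realType.
Local Notation p := (@smooth_seminorm R).

Lemma poly_primitive (q : {poly rat}) (c : rat) : exists P : {poly rat},
  deriv P = q /\ P.[0] = c.
Proof.
exists (\poly_(i < (size q).+1) (if i is i'.+1 then q`_i' / i%:R else c));
  split.
  apply/polyP => i; rewrite coef_deriv coef_poly ltnS.
  case: ltnP => [iq|qi]; last by rewrite mul0rn nth_default.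
  by rewrite -[LHS]mulr_natr divfK// pnatr_eq0.
by rewrite horner_coef0 coef_poly.
Qed.

(** Induction on the order: the derivative is approximated first, this approximation is integrated
    with a rational constant close to [f 0], and the mean value theorem bounds the resulting error
    at order 0. *)
Lemma rat_poly_smooth_approx m (f : smoothFun R) (M e : R) : 0 < e ->
  exists q : {poly rat}, forall k x, (k <= m)%N -> `|x| <= M ->
    `|(f - smooth_poly (map_poly ratr q))^`(k) x| <= e.
Proof.
elim: m f e => [|m IHm] f e e0.
  have e20 : 0 < e / 2 by rewrite divr_gt0.
  have [P PP] := weierstrass M (@continuous_derive1n R f 0) e20.
  have [q qP] := rat_poly_approx P M e20.
  exists q => k x; rewrite leqn0 => /eqP -> xM; rewrite derive1n_smoothB.
  rewrite -(subrK P.[x] (f^`(0) x)) -addrA (le_trans (ler_normD _ _))//.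
  by rewrite [leRHS]splitr lerD ?PP ?qP.
have sf' : smooth (derive1 f).
  by move=> k x; rewrite -derive1Sn; exact: derivable_derive1n.
have M1 : 0 < `|M| + 1 by rewrite ltr_wpDl.
have e20 : 0 < e / 2 by rewrite divr_gt0.
have [|q' q'P] := IHm (mkSmooth sf') (Num.min e (e / 2 / (`|M| + 1))).
  by rewrite lt_min e0 divr_gt0.
have [c cP] : exists c : rat, `|f^`(0) 0 - ratr c| <= e / 2.
  have [|c] := @rat_in_itvoo R (f^`(0) 0 - e / 2) (f^`(0) 0 + e / 2).
    by rewrite ltrD2l gtrN.
  rewrite in_itv/= => /andP[c1 c2]; exists c; rewrite ler_norml; lra.
have [q [qq' q0]] := poly_primitive q' c.
exists q; set d := f - _.
have dS k x : d^`(k.+1) x =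
    (mkSmooth sf' - smooth_poly (map_poly ratr q'))^`(k) x.
  rewrite /d !derive1n_smoothB -derive1Sn; congr (_ - _).
  by rewrite !derive1n_smooth_poly derivSn deriv_map qq'.
move=> [|k] x km xM; last first.
  rewrite dS (le_trans (q'P k x km xM))//.
  by rewrite ge_min lexx.
rewrite -(subrK (d^`(0) 0) (d^`(0) x)) (le_trans (ler_normD _ _))//
  [leRHS]splitr.
rewrite lerD//; last first.
  by rewrite /d derive1n_smoothB /= !horner_coef0 coef_map/= -horner_coef0 q0.
rewrite (le_trans (@derive1n_mvt R d 0 (e / 2 / (`|M| + 1)) M 0 x _ _ _))//.
- move=> z zM; rewrite dS (le_trans (q'P 0 z _ zM))//.
  by rewrite ge_min lexx orbT.
- by rewrite normr0 (le_trans _ xM).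
rewrite subr0 mulrC; apply: mulr_div1p_le => //; first exact: ltW.
by rewrite (le_trans xM)// ler_norm.
Qed.

Lemma rat_poly_smooth_dense (f : smoothFun R) n e : 0 < e ->
  exists q : {poly rat}, p n (f - smooth_poly (map_poly ratr q)) < e.
Proof.
move=> e0; have [|q qP] := @rat_poly_smooth_approx n f n%:R (e / 2 / n.+1%:R).
  by rewrite !divr_gt0.
exists q; rewrite (le_lt_trans (smooth_seminorm_le qP))// mulrC divfK//.
by rewrite ltr_pdivrMr// ltr_pMr// ltr1n.
Qed.

End rational_polynomials.

(** * Universality in the closed span, and the dense subspace *)

Section universal_subspaces.
Variables (R : realType) (alpha : nat -> nat -> R) (mu : nat -> nat).
Hypothesis alpha_cvg : forall k, cvg (alpha n k @[n --> \oo]).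
Hypothesis mu_increasing : increasing_seq mu.
Local Notation S := (weighted_taylor alpha).
Local Notation p := (@smooth_seminorm R).
Variables (e J : nat -> nat) (g : nat -> smoothFun R).
Local Notation K l := (lacunary (e l)).
Let f l := smooth_poly 'X^(K l) + g l.
Hypothesis e_incr : forall i, (e i < e i.+1)%N.
Hypothesis J_ge : forall i, (i <= J i)%N.
Hypothesis g_small :
  forall l n, (n <= l.+1)%N -> p n (g l) <= 2 * stage_error R l.
Hypothesis f_flat : forall i l, (i < l)%N ->
  forall k, (k <= mu (J i))%N -> (f l)^`(k) 0 = 0.
Hypothesis f_target : forall i l, (l <= i)%N -> forall x, `|x| <= i%:R ->
  `|S (mu (J i)) (f l) x - stage_target i l x| <= stage_error R i.
Variable G : nat -> smoothFun R -> R.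
Hypothesis G_linear : forall l a u v, G l (a *: u + v) = a * G l u + G l v.
Hypothesis G_lipschitz : forall l, seminorm_lipschitz (G l).
Hypothesis G_dual : forall l j, G l (f j) = (j == l)%:R.

Lemma stage_error_le i : i.+1%:R * stage_error R i <= i.+1%:R^-1.
Proof.
(* With [i.+4] in place of [i.+1], the square at most doubles at each step from [i = 0] on, so the
   induction closes. *)
have sq : (i.+4 ^ 2 <= 2 ^ (i + 10))%N.
  elim: i => // i; rewrite addSn (expnS 2); move: (2 ^ (i + 10))%N => t.
  have -> : (i.+1.+4 ^ 2 = i.+4 ^ 2 + (2 * i + 9))%N by rewrite -!mulnn; ring.
  have -> : (i.+4 ^ 2 = i * i + 8 * i + 16)%N.
    by rewrite -mulnn; ring.
  by move: (i * i)%N => w; lia.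
rewrite /stage_error ler_pdivrMr ?exprn_gt0// ler_pdivlMl//.
by rewrite -expr2 -!natrX ler_nat (leq_trans _ sq)// leq_exp2r// leqW// leqW.
Qed.

Lemma weighted_taylor_sum m n (c : nat -> R) (v : nat -> smoothFun R) x :
  S m (\sum_(l < n) c l *: v l) x = \sum_(l < n) c l * S m (v l) x.
Proof.
elim: n => [|n IHn].
  by rewrite !big_ord0 weighted_taylor_eq0// => k _; exact: derive1n_smooth0.
by rewrite !big_ord_recr weighted_taylorD IHn weighted_taylorZ.
Qed.

(** Some coefficient [G l0 u] is non-zero. At a stage [i] with target [(l0, q)], where the target of
    [q] approximates [h / G l0 u], the partial sum of [u] only involves [f 0, ..., f i]: the term of
    index [l0] gives about [h], and the others, close to 0 with bounded coefficients, add up to a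
    small error. *)
Lemma closed_span_universal u : closure (finite_span f) u -> u <> 0 ->
  universal_series alpha mu u.
Proof.
move=> Vu u0.
have [l0 Gu0] : exists l0, G l0 u != 0.
  apply: contrapT => /forallNP Gu; apply: u0.
  apply: (closed_span_eq0 e_incr g_small G_linear G_lipschitz G_dual Vu).
  by move=> l; apply/eqP/negPn/negP/Gu.
have [C C0 CP] := closed_span_coef_le e_incr g_small G_linear G_lipschitz
  G_dual (ltn0Sn 0).
pose B := C * p 1 u.
have B0 : 0 <= B by rewrite mulr_ge0// smooth_seminorm_ge0.
have GB l : `|G l u| <= B.
  by have := CP u Vu l; rewrite expr1n mulr1.
apply/(universal_seriesP _ mu_increasing) => h ch h0 s.
have a0 : 0 < `|G l0 u| by rewrite normr_gt0.
have e0 : 0 < (s.+1.*2)%:R^-1 :> R by rewrite invr_gt0 ltr0n double_gt0.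
have [|||q qP] := @rat_target_dense R (fun x => (G l0 u)^-1 * h x) s%:R
    ((s.+1.*2)%:R^-1 / `|G l0 u|).
- by move=> x; apply: cvgM; [exact: cvg_cst|exact: ch].
- by rewrite h0 mulr0.
- by rewrite divr_gt0.
have B1 : 0 < B + 1 by rewrite ltr_wpDl.
have [|N NP] := @invSn_lt R ((s.+1.*2)%:R^-1 / (B + 1)); first by rewrite
  divr_gt0.
(* The three lower bounds ensure that the interval of radius [s] is covered, that [f l0] is already
   introduced, and that the accumulated error is small. *)
have [i si ti] := target_recurrent l0 q (maxn s (maxn l0 N)).
move: si; rewrite !geq_max => /and3P[si l0i Ni].
exists (J i) => [|x xs]; first exact: leq_trans (J_ge i).
have xi : `|x| <= i%:R by rewrite (le_trans xs)// ler_nat.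
have SE : S (mu (J i)) u x = \sum_(l < i.+1) G l u * S (mu (J i)) (f l) x.
  rewrite -(weighted_taylor_sum (mu (J i)) i.+1 (fun l => G l u) f).
  apply: eq_weighted_taylor => k ki.
  rewrite (closed_span_derive1n G_linear G_lipschitz G_dual (i := i) (k := k) _
    Vu).
    rewrite derive1n_smooth_sum; apply: eq_bigr => l _.
    by rewrite derive1n_smoothZ.
  by move=> l il; exact: f_flat il k ki.
have TE : \sum_(l < i.+1) G l u * stage_target i l x = G l0 u * rat_target q x.
  have l0i1 : (l0 < i.+1)%N by [].
  rewrite (bigD1 (Ordinal l0i1))//= /stage_target ti/= eqxx big1 ?addr0// => l.
  by rewrite -val_eqE/= => /negbTE ->; rewrite mulr0.
have close : `|S (mu (J i)) u x - G l0 u * rat_target q x| <= (s.+1.*2)%:R^-1.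
  rewrite SE -TE -sumrB (le_trans (ler_norm_sum _ _ _))//.
  rewrite (@le_trans _ _ (\sum_(l < i.+1) B * stage_error R i))//.
    apply: ler_sum => l _; rewrite -mulrBr normrM ler_pM//.
    by apply: f_target; rewrite // -ltnS.
  rewrite sumr_const card_ord -[leLHS]mulr_natl mulrCA.
  rewrite (le_trans (ler_wpM2l B0 (stage_error_le i)))//.
  rewrite (le_trans (ler_wpM2l B0 (ltW (NP i Ni))))//.
  exact: mulr_div1p_le (ltW e0) B0 (lexx B).
have -> : S (mu (J i)) u x - h x = (S (mu (J i)) u x - G l0 u * rat_target q x)
  -
    G l0 u * ((G l0 u)^-1 * h x - rat_target q x).
  by rewrite mulrBr mulVKf//; ring.
rewrite (le_trans (ler_normB _ _))// invSn_halve lerD// normrM mulrC.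
by rewrite -ler_pdivlMr// qP.
Qed.

Let finite_span_f l : finite_span f (f l).
Proof.
exists l.+1, (fun j => (j == l)%:R).
rewrite big_ord_recr/= eqxx scale1r big1 ?add0r// => i _.
by rewrite ltn_eqF ?scale0r.
Qed.

Let G0 l : G l 0 = 0.
Proof.
by have := G_linear l (-1) 0 0; rewrite scaler0 addr0 mulN1r addNr.
Qed.

Let G_sum (I : Type) (r : seq I) l (c : I -> R) (v : I -> smoothFun R) :
  G l (\sum_(j <- r) c j *: v j) = \sum_(j <- r) c j * G l (v j).
Proof.
by elim/big_rec2 : _ => [|j a b _ <-]; [exact: G0|rewrite G_linear].
Qed.

(** With [n] generators, the identity matrix of size [n.+1], made of the values [G j (f l)], would
    factor through rank at most [n]. *)
Lemma closed_span_infinite : ~ finite_dimensional (closure (finite_span f)).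
Proof.
move=> [n [v [_ vP]]].
have /choice[c cP] : forall l, exists c : 'I_n -> R,
    f l = \sum_(i < n) c i *: v i.
  by move=> l; apply: vP; apply: subset_closure; exact: finite_span_f.
pose C := \matrix_(l < n.+1, i < n) c l i.
pose H := \matrix_(i < n, j < n.+1) G j (v i).
have CH : C *m H = 1%:M.
  apply/matrixP => l j; rewrite !mxE -[(l == j)]/(nat_of_ord l == nat_of_ord j).
  rewrite -G_dual cP G_sum; apply: eq_bigr => i _.
  by rewrite !mxE.
have := mxrankM_maxl C H; rewrite CH mxrank1 leqNgt ltnS.
by rewrite rank_leq_col.
Qed.

Let rat_smooth (q : {poly rat}) : smoothFun R := smooth_poly (map_poly ratr q).

Let d l : R := (l.+1%:R * (p l (f l) + 1))^-1.

Let d_gt0 l : 0 < d l.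
Proof. by rewrite invr_gt0 mulr_gt0// ltr_wpDl// smooth_seminorm_ge0. Qed.

(** Every rational polynomial recurs as [(target l).2] for arbitrarily large [l], and the weight
    [d l] brings [d l *: f l] below the inverse of [l.+1] in [p l]: this gives the density. *)
Let v l := rat_smooth (target l).2 + d l *: f l.

(** The polynomial part only translates the target. The other part lies in the span of the [f l],
    and is non-zero because [G l] recovers [c l * d l] from it. *)
Let span_v_universal n (c : nat -> R) : \sum_(l < n) c l *: v l <> 0 ->
  universal_series alpha mu (\sum_(l < n) c l *: v l).
Proof.
have -> : \sum_(l < n) c l *: v l = \sum_(l < n) (c l * d l) *: f l +
    \sum_(l < n) c l *: rat_smooth (target l).2.
  rewrite -big_split/=; apply: eq_bigr => l _.
  by rewrite scalerDr scalerA addrC.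
set w := \sum_(l < n) _ *: f l; set y := \sum_(l < n) _ => wy0.
have [c0|[l [ln cl]]] : (forall l, (l < n)%N -> c l = 0) \/
    exists l, (l < n)%N /\ c l != 0.
  have [|/existsNP[l /not_implyP[ln /eqP cl]]] :=
    pselect (forall l, (l < n)%N -> c l = 0); first by left.
  by right; exists l.
  by exfalso; apply: wy0; rewrite /w /y !big1 ?addr0// => l _;
    rewrite c0 ?mul0r ?scale0r.
apply: (@universal_seriesD R alpha mu mu_increasing alpha_cvg w y
  (\max_(l < n) size (target l).2)) => [k sk|].
  rewrite derive1n_smooth_sum big1// => i _.
  rewrite derive1n_smoothZ derive1n_smooth_poly0 coef_map/= nth_default.
    by rewrite rmorph0 mul0r mulr0.
  apply: leq_trans sk.
  exact: (@leq_bigmax _ (fun l : 'I_n => size (target l).2) i).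
apply: closed_span_universal.
  by apply: subset_closure; exists n, (fun l => c l * d l).
move=> w0; have : G l w = c l * d l.
  rewrite /w G_sum (bigD1 (Ordinal ln))//= G_dual eqxx mulr1 big1 ?addr0// => i.
  by rewrite -val_eqE/= G_dual => /negbTE ->; rewrite mulr0.
rewrite w0 G0 => /esym/eqP; rewrite mulf_eq0 (negbTE cl)/=.
by rewrite gt_eqF.
Qed.

Let v_dense (O : set (smoothFun R)) u : open O -> O u -> exists l, O (v l).
Proof.
move=> oO Ou; have /nbhs_smoothP[n [a [a0 aO]]] := open_nbhs_nbhs (conj oO Ou).
have a20 : 0 < a / 2 by rewrite divr_gt0.
have [q qP] := rat_poly_smooth_dense u n a20.
have [N NP] := invSn_lt a20.
have [l + tl] := target_recurrent 0 q (maxn n N); rewrite geq_max => /andP[nl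
  Nl].
exists l; apply: aO => /=; rewrite /v tl/= opprD addrA.
rewrite (le_lt_trans (ler_smooth_seminormD _ _ _))// smooth_seminormN.
rewrite [ltRHS]splitr ltrD// smooth_seminormZ gtr0_norm//.
rewrite (le_lt_trans _ (NP l Nl))// (@le_trans _ _ (d l * (p l (f l) + 1)))//.
  rewrite ler_wpM2l ?(ltW (d_gt0 l))//.
  by rewrite (le_trans (le_smooth_seminorm _ nl))// lerDl.
rewrite /d invfM mulfVK ?gt_eqF// ltr_wpDl//.
exact: smooth_seminorm_ge0.
Qed.

Let v_universal l : universal_series alpha mu (v l).
Proof.
have -> : v l = d l *: f l + rat_smooth (target l).2 by rewrite addrC.
apply: (@universal_seriesD R alpha mu mu_increasing alpha_cvg _ _
  (size (target l).2)) => [k sk|].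
  rewrite derive1n_smooth_poly0 coef_map/= nth_default//.
  by rewrite rmorph0 mul0r.
apply: closed_span_universal.
  apply: subset_closure.
  have /set_mem := (linear_subspace_finite_span f).2 (d l) _ _
    (mem_set (finite_span_f l)) (linear_subspace_finite_span f).1.
  by rewrite addr0.
move=> df0; have := G_linear l (d l) (f l) 0.
rewrite addr0 df0 !G0 G_dual eqxx mulr1 addr0 => /esym/eqP.
by rewrite gt_eqF.
Qed.

Lemma dense_universal_smooth : dense (universal_smooth alpha mu).
Proof.
move=> O [u Ou] oO; have [l Ol] := v_dense oO Ou.
by exists (v l); split=> //; exact: v_universal.
Qed.

Lemma dense_universal_subspace : exists V : set (smoothFun R),
  [/\ linear_subspace V, dense V & contains_apart0 (universal_smooth alpha mu)
    V].
Proof.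
exists (finite_span v); split; first exact: linear_subspace_finite_span.
- move=> O [u Ou] oO; have [l Ol] := v_dense oO Ou.
  exists (v l); split=> //; exists l.+1, (fun j => (j == l)%:R).
  rewrite big_ord_recr/= eqxx scale1r big1 ?add0r// => i _.
  by rewrite ltn_eqF ?scale0r.
- by move=> _ [[n [c ->]] /= w0]; exact: span_v_universal.
Qed.

Lemma closed_universal_subspace : exists V : set (smoothFun R),
  [/\ linear_subspace V, closed V, ~ finite_dimensional V &
      contains_apart0 (universal_smooth alpha mu) V].
Proof.
exists (closure (finite_span f)); split.
- exact/linear_subspace_closure/linear_subspace_finite_span.
- exact: closed_closure.
- exact: closed_span_infinite.
- by move=> u [Vu /= u0]; exact: closed_span_universal.
Qed.

End universal_subspaces.

Theorem theorem3p1 (R : realType) (alpha : nat -> nat -> R) (mu : nat -> nat)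
    (alpha_neq0 : forall n k, (k <= n)%N -> alpha n k != 0)
    (alpha_cvg : forall k, cvg (alpha n k @[n --> \oo]))
    (mu_increasing : increasing_seq mu) :
  (exists f : R -> R, smooth f /\ universal_series alpha mu f) /\
  dense (universal_smooth alpha mu) /\
  Gdelta (universal_smooth alpha mu) /\
  (exists V : set (smoothFun R),
    [/\ linear_subspace V, dense V &
        contains_apart0 (universal_smooth alpha mu) V]) /\
  (exists V : set (smoothFun R),
    [/\ linear_subspace V, closed V, ~ finite_dimensional V &
        contains_apart0 (universal_smooth alpha mu) V]).
Proof.
have [e [J [g]]] :=
  universal_family alpha_neq0 alpha_cvg mu_increasing.
move=> [e_incr J_ge g_flat g_small fP].
have /choice[G GP] := biorthogonal e_incr g_flat.
have G_linear l a u v : G l (a *: u + v) = a * G l u + G l v by have [] := GP l.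
have G_lipschitz l : seminorm_lipschitz (G l) by have [] := GP l.
have G_dual l j : G l (smooth_poly 'X^(lacunary (e j)) + g j) = (j == l)%:R.
  by have [] := GP l.
have f_flat i l := (fP i l).1; have f_target i l := (fP i l).2.
have dU : dense (universal_smooth alpha mu).
  exact: (dense_universal_smooth alpha_cvg mu_increasing e_incr J_ge g_small
    f_flat f_target G_linear G_lipschitz G_dual).
split.
  (* The whole space is open and non-empty, so density provides a universal function. *)
  have [|f [_ Uf]] := dU setT _ openT; first by exists 0.
  by exists f; split=> //; exact: smoothFunP.
split=> //; split; first exact: Gdelta_universal_smooth.
split.
  exact: (dense_universal_subspace alpha_cvg mu_increasing e_incr J_ge g_small
    f_flat f_target G_linear G_lipschitz G_dual).
exact: (closed_universal_subspace mu_increasing e_incr J_ge g_small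
  f_flat f_target G_linear G_lipschitz G_dual).
Qed.
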